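(* Let $N\ge1$, $0<s<1$, $1<p<2$, $\gamma_1=sp/(p-1)$ and $u_0(x)=C|x|^{\gamma_1}$ with $C>0$. Let $u_{0n}$ be any nondecreasing sequence of nonnegative and integrable approximations to $u_0$ (converging monotonically to $u_0$), and let $u_n(x,t)$ be the corresponding semigroup solutions of $\partial_tu+\mathcal L_{s,p}u=0$. Then for every $t>0$ and $x\in\mathbb R^N$ $$u_n(x,t)\to\infty\qquad(n\to\infty),$$ and the divergence holds pointwise in $(x,t)$, locally in $L^1_{loc}(\mathbb R^N)$ for every $t>0$, and also in the local $L^1_{x,t}$ norm in $Q_T=\mathbb R^N\times(0,T)$ (i.e. the integrals of $u_n$ over balls at fixed $t>0$, and over local space-time cylinders in $Q_T$, tend to infinity). Moreover, $$\lim_{\gamma\to\gamma_1^-}F_\gamma(x)=\infty$$ uniformly in $x\in\mathbb R^N$, where for $0<\gamma<\gamma_1$, $F_\gamma$ is the profile of the self-similar minimal solution $u_\gamma(x,t)=t^{\gamma\beta}F_\gamma(xt^{-\beta})$, $\beta=1/(sp+\gamma(2-p))$, with initial data $C|x|^\gamma$.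
   Context: Let $\Phi_p(z)=|z|^{p-2}z$ and $\mathcal L_{s,p}(u)(x)=P.V.\int_{\mathbb R^N}\frac{\Phi_p(u(x)-u(y))}{|x-y|^{N+sp}}\,dy$. In $L^2(\mathbb R^N)$ it is the subdifferential of the convex functional $J(u)=\frac1{2p}\iint\frac{|u(x)-u(y)|^p}{|x-y|^{N+sp}}\,dxdy$; it generates a contraction semigroup $S_t$ which extends to an order-preserving contraction semigroup on every $L^q(\mathbb R^N)$, $1\le q<\infty$; semigroup solutions are $S_tu_0$ with $u_0\in L^q(\mathbb R^N)$. For $0<\gamma<\gamma_1$, the minimal solution $u_\gamma$ with data $C|x|^\gamma$ is the (finite) limit of the semigroup solutions with data any nondecreasing sequence of nonnegative functions in $L^1(\mathbb R^N)\cap L^\infty(\mathbb R^N)$ converging monotonically to $C|x|^\gamma$; it exists, is independent of the sequence, and has the stated self-similar form with $F_\gamma$ continuous, positive, radially symmetric and increasing in $|x|$. *)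

(* Defs.v *)
From HB Require Import structures.
From mathcomp Require Import all_boot all_order all_algebra.
From mathcomp Require Import all_classical all_reals all_analysis.

Set Implicit Arguments.
Unset Strict Implicit.
Unset Printing Implicit Defensive.
Import Order.TTheory GRing.Theory Num.Theory.
Import numFieldNormedType.Exports.

Local Open Scope classical_set_scope.
Local Open Scope ring_scope.

(* R^N is 'rV[R]_N.  Its sigma-algebra is generated by the coordinates (hence
   is the Borel one), and its Lebesgue measure is the N-fold product measure,
   transported along R * R^n -> R^(1 + n). *)

Definition measure_rV_display : measure_display -> measure_display.
Proof. exact. Qed.

Section measurable_rV.
Context {d} {T : measurableType d}.
Variable n : nat.

Let coors : 'I_n -> 'rV[T]_n -> T := fun i x => x ord0 i.

Let rV_set0 : g_sigma_preimage coors set0.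
Proof. exact: sigma_algebra0. Qed.

Let rV_setC A : g_sigma_preimage coors A -> g_sigma_preimage coors (~` A).
Proof. exact: sigma_algebraC. Qed.

Let rV_bigcup (F : (set 'rV[T]_n)^nat) :
  (forall i, g_sigma_preimage coors (F i)) ->
  g_sigma_preimage coors (\bigcup_i (F i)).
Proof. exact: sigma_algebra_bigcup. Qed.

HB.instance Definition _ := @isMeasurable.Build (measure_rV_display d)
  'rV[T]_n (g_sigma_preimage coors) rV_set0 rV_setC rV_bigcup.

End measurable_rV.

Lemma measurable_rV_coord d (T : measurableType d) n (i : 'I_n) :
  measurable_fun [set: 'rV[T]_n] (fun x : 'rV[T]_n => x ord0 i).
Proof.
move=> _ Y mY; rewrite setTI; apply: sub_sigma_algebra => /=.
rewrite -bigcup_seq/=; exists i => /=; first by rewrite mem_index_enum.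
by exists Y => //; rewrite setTI.
Qed.

Lemma measurable_fun_rVP d1 d2 (T1 : measurableType d1) (T2 : measurableType d2)
    n (f : T1 -> 'rV[T2]_n) :
  (forall i, measurable_fun [set: T1] (fun x => f x ord0 i)) ->
  measurable_fun [set: T1] f.
Proof.
move=> mf _ Y mY.
pose G := \big[setU/set0]_(i < n)
  preimage_set_system setT (fun x : 'rV[T2]_n => x ord0 i) measurable.
suff : <<s G >> `<=` image_set_system setT f measurable by move/(_ _ mY).
apply: smallest_sub; first exact/sigma_algebra_image/sigma_algebra_measurable.
rewrite /G -bigcup_seq => A [i _ [B mB <-]].
by rewrite /image_set_system/= setTI; exact: (mf i measurableT B mB).
Qed.

Section cons_rV.
Context (R : realType) (n : nat).

Definition cons_rV (z : measurableTypeR R * 'rV[R]_n) : 'rV[R]_(1 + n) :=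
  row_mx (z.1)%:M z.2.

Definition uncons_rV (x : 'rV[R]_(1 + n)) : measurableTypeR R * 'rV[R]_n :=
  (x ord0 ord0, rsubmx x).

Lemma cons_rV0 z : cons_rV z ord0 ord0 = z.1.
Proof.
have -> : (ord0 : 'I_(1 + n)) = lshift n (ord0 : 'I_1) by exact/val_inj.
by rewrite /cons_rV row_mxEl mxE eqxx.
Qed.

Lemma cons_rVS z (i : 'I_n) : cons_rV z ord0 (lift ord0 i) = z.2 ord0 i.
Proof.
have -> : lift ord0 i = rshift 1 i :> 'I_(1 + n) by exact/val_inj.
by rewrite /cons_rV row_mxEr.
Qed.

Lemma cons_rVK : cancel cons_rV uncons_rV.
Proof.
by case=> a v; rewrite /uncons_rV cons_rV0 /cons_rV row_mxKr.
Qed.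

Lemma uncons_rVK : cancel uncons_rV cons_rV.
Proof.
move=> x; apply/rowP => i; rewrite /cons_rV /uncons_rV/=.
rewrite mxE; case: splitP => j ij; rewrite !mxE.
  by rewrite !ord1 eqxx mulr1n; congr (x _ _); apply/val_inj; rewrite /= ij ord1.
by congr (x _ _); apply/val_inj; rewrite /= ij.
Qed.

Lemma measurable_cons_rV : measurable_fun setT cons_rV.
Proof.
apply: measurable_fun_rVP => i; rewrite /cons_rV.
case: (splitP i) => j ij.
  have -> : (fun z : measurableTypeR R * 'rV[R]_n =>
      (row_mx z.1%:M z.2 : 'rV[R]_(1 + n)) ord0 i) = fst.
    apply/funext => z; have -> : i = lshift n j by exact/val_inj.
    by rewrite row_mxEl mxE !ord1 eqxx.
  exact: measurable_fst.
have -> : (fun z : measurableTypeR R * 'rV[R]_n =>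
    (row_mx z.1%:M z.2 : 'rV[R]_(1 + n)) ord0 i) =
    (fun x : 'rV[R]_n => x ord0 j) \o snd.
  apply/funext => z; have -> : i = rshift 1 j by exact/val_inj.
  by rewrite row_mxEr.
by apply: measurableT_comp; [exact: measurable_rV_coord|exact: measurable_snd].
Qed.

Lemma measurable_uncons_rV : measurable_fun setT uncons_rV.
Proof.
apply/measurable_fun_pairP; split; first exact: measurable_rV_coord.
apply: measurable_fun_rVP => i.
have -> : (fun x : 'rV[R]_(1 + n) => (snd \o uncons_rV) x ord0 i) =
    (fun x => x ord0 (rshift 1 i)).
  by apply/funext => x; rewrite /= mxE.
exact: measurable_rV_coord.
Qed.

Variable mu : {sigma_finite_measure set 'rV[R]_n -> \bar R}.
Local Open Scope ereal_scope.

Definition cons_measure : set 'rV[R]_(1 + n) -> \bar R :=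
  pushforward (lebesgue_measure \x mu) cons_rV.

Let measurable_preimage_cons A : measurable A -> measurable (cons_rV @^-1` A).
Proof.
by move=> mA; rewrite -[X in measurable X]setTI; exact: measurable_cons_rV.
Qed.

Let cons_measure0 : cons_measure set0 = 0.
Proof. by rewrite /cons_measure /pushforward preimage_set0 measure0. Qed.

Let cons_measure_ge0 A : 0 <= cons_measure A.
Proof. by rewrite /cons_measure /pushforward; exact: measure_ge0. Qed.

Let cons_measure_sigma_additive : semi_sigma_additive cons_measure.
Proof.
move=> F mF tF mUF; rewrite /cons_measure /pushforward preimage_bigcup.
apply: measure_semi_sigma_additive.
- by move=> k; exact: measurable_preimage_cons.
- apply/trivIsetP => /= i j _ _ ij; rewrite -preimage_setI.
  by move/trivIsetP : tF => /(_ _ _ _ _ ij) ->//; rewrite preimage_set0.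
- by rewrite -preimage_bigcup; exact: measurable_preimage_cons.
Qed.

HB.instance Definition _ := isMeasure.Build _ _ _ cons_measure
  cons_measure0 cons_measure_ge0 cons_measure_sigma_additive.

Let cons_measure_sigma_finite : sigma_finite setT cons_measure.
Proof.
have /sigma_finiteP[F [TF ndF Foo]] := sigma_finiteT (@lebesgue_measure R).
have /sigma_finiteP[G [TG ndG Goo]] := sigma_finiteT mu.
exists (fun k => uncons_rV @^-1` (F k `*` G k)).
  rewrite -preimage_bigcup; apply/seteqP; split => // x _.
  have [k _ Fk] : (\bigcup_k F k) (uncons_rV x).1 by rewrite -TF.
  have [l _ Gl] : (\bigcup_k G k) (uncons_rV x).2 by rewrite -TG.
  exists (maxn k l) => //; split.
    by move: Fk; exact/subsetPset/ndF/leq_maxl.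
  by move: Gl; exact/subsetPset/ndG/leq_maxr.
move=> k; have [mF Fk] := Foo k; have [mG Gk] := Goo k; split.
  rewrite -[X in measurable X]setTI; apply: measurable_uncons_rV => //.
  exact: measurableX.
rewrite /cons_measure /pushforward -comp_preimage.
rewrite (_ : uncons_rV \o cons_rV = id).
  rewrite preimage_id product_measure1E//.
  by rewrite lte_mul_pinfty// ge0_fin_numE.
by apply/funext => z; rewrite /= cons_rVK.
Qed.

HB.instance Definition _ := Measure_isSigmaFinite.Build _ _ _ cons_measure
  cons_measure_sigma_finite.

End cons_rV.

Fixpoint lebesgue_rV (R : realType) (n : nat) :
    {sigma_finite_measure set 'rV[R]_n -> \bar R} :=
  match n with
  | 0%N => dirac (0 : 'rV[R]_0)
  | m.+1 => cons_measure (lebesgue_rV R m)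
  end.

Lemma lebesgue_rV_box (R : realType) (n : nat) (A : 'I_n -> set R) :
  (forall i, measurable (A i)) ->
  lebesgue_rV R n [set x | forall i, A i (x ord0 i)] =
  (\prod_(i < n) lebesgue_measure (A i))%E.
Proof.
elim: n A => [|n IH] A mA /=.
  rewrite big_ord0 diracE (_ : _ \in _ = true)//.
  by apply/mem_set => -[].
rewrite big_ord_recl -(IH (fun i => A (lift ord0 i)))//.
have mB : measurable
    [set x : 'rV[R]_n | forall i, A (lift ord0 i) (x ord0 i)].
  have -> : [set x : 'rV[R]_n | forall i, A (lift ord0 i) (x ord0 i)] =
      \bigcap_(i in [set: 'I_n]) (fun x : 'rV[R]_n => x ord0 i) @^-1`
        A (lift ord0 i).
    by apply/seteqP; split => [x Ax i _|x Ax i]; [exact: Ax|exact: (Ax i)].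
  apply: fin_bigcap_measurable => // i _.
  by rewrite -[X in measurable X]setTI; exact: measurable_rV_coord.
rewrite /cons_measure /pushforward -product_measure1E//; [|exact: mA].
congr product_measure1; apply/seteqP; split => -[a v] /=.
  by move=> H; split=> [|i]; [have := H ord0; rewrite (cons_rV0 (a, v))|
    have := H (lift ord0 i); rewrite (cons_rVS (a, v))].
move=> [Aa Av] i; case: (unliftP ord0 i) => [j ->|->].
  by rewrite (cons_rVS (a, v)); exact: Av.
by rewrite (cons_rV0 (a, v)).
Qed.

Section fractional_p_laplacian.
Context {R : realType} {N : nat}.
Local Notation E := 'rV[R]_N.
Local Notation mu := (lebesgue_rV R N).
Implicit Types (f g u v w xi : E -> R) (S : R -> (E -> R) -> E -> R).

(* The norm of the library on 'rV[R]_N is the sup norm. *)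
Definition enorm (x : E) : R := Num.sqrt (\sum_(i < N) x ord0 i ^+ 2).

Definition eball (x : E) (r : R) : set E := [set y | enorm (y - x) < r].

Definition dist_Lq (q : R) f g : \bar R := 'N[mu]_(q%:E)[EFin \o (f \- g)].

(* The functional J; the integrand vanishes on the diagonal. *)
Definition gagliardo (s p : R) u : \bar R :=
  (((2 * p)^-1)%:E * \int[mu \x mu]_z
    (`|u z.1 - u z.2| `^ p / enorm (z.1 - z.2) `^ (N%:R + s * p))%:E)%E.

(* xi belongs to the subdifferential of J at v in L^2, i.e. xi = L_{s,p} v.
   Taking w = 0 shows that v then lies in the effective domain of J. *)
Definition subdiff (s p : R) v xi : Prop :=
  [/\ v \in Lfun mu 2%:E, xi \in Lfun mu 2%:E &
    forall w, w \in Lfun mu 2%:E ->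
      (gagliardo s p v + (\int[mu]_x (xi x * (w x - v x)))%:E
        <= gagliardo s p w)%E].

(* v = (I + h L_{s,p})^{-1} f *)
Definition resolvent (s p h : R) f v : Prop :=
  subdiff s p v (fun x => (f x - v x) / h).

(* g = lim_n (I + (t/n) L_{s,p})^{-n} f in L^2: the value at time t of the
   semigroup generated by the subdifferential of J (Crandall-Liggett). *)
Definition generated_value (s p t : R) f g : Prop :=
  g \in Lfun mu 2%:E /\
  exists V : nat -> nat -> E -> R,
    [/\ forall n, V n 0%N = f,
        forall n k, (k < n)%N -> resolvent s p (t / n%:R) (V n k) (V n k.+1) &
        dist_Lq 2 (V n n) g @[n --> \oo] --> 0%E].

Record contraction_semigroup (q : R) S : Prop := {
  semigroup_Lq : forall t f,
    0 <= t -> f \in Lfun mu q%:E -> S t f \in Lfun mu q%:E;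
  semigroup_0 : forall f,
    f \in Lfun mu q%:E -> {ae mu, forall x, S 0 f x = f x};
  semigroup_D : forall t r f, 0 <= t -> 0 <= r -> f \in Lfun mu q%:E ->
    {ae mu, forall x, S (t + r) f x = S t (S r f) x};
  semigroup_contraction : forall t f g,
    0 <= t -> f \in Lfun mu q%:E -> g \in Lfun mu q%:E ->
    (dist_Lq q (S t f) (S t g) <= dist_Lq q f g)%E;
  semigroup_continuous : forall f,
    f \in Lfun mu q%:E -> dist_Lq q (S t f) f @[t --> 0^'+] --> 0%E }.

Definition order_preserving (q : R) S : Prop := forall t f g,
  0 <= t -> f \in Lfun mu q%:E -> g \in Lfun mu q%:E ->
  {ae mu, forall x, f x <= g x} -> {ae mu, forall x, S t f x <= S t g x}.

(* S t f is the semigroup solution at time t with data f in some L^q.  The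
   last clause determines S on L^2, hence, by density and contractivity, on
   every L^q; the function S t f is only determined up to null sets. *)
Definition fractional_p_semigroup (s p : R) S : Prop :=
  (forall q, 1 <= q -> contraction_semigroup q S /\ order_preserving q S) /\
  (forall t f, 0 < t -> f \in Lfun mu 2%:E -> generated_value s p t f (S t f)).

Definition monotone_approx (f_ : nat -> E -> R) f : Prop :=
  {ae mu, forall x, [/\ forall n, 0 <= f_ n x,
                        forall n, f_ n x <= f_ n.+1 x &
                        f_ n x @[n --> \oo] --> f x]}.

(* Pointwise value of a class in L^1_loc: the (lower) limit of its means over
   shrinking balls.  It does not depend on the representative, it is a.e. equal
   to it, and it is the value of the continuous representative if any. *)
Definition point_value f (x : E) : \bar R :=
  limf_einf (fun r : R =>
    ((fine (mu (eball x r)))^-1%:E * \int[mu]_(y in eball x r) (f y)%:E)%E)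
    0^'+.

Definition minimal_solution S (C gamma : R) (u : R -> E -> R) : Prop :=
  forall f_ : nat -> E -> R,
    (forall n, f_ n \in Lfun mu 1%E /\ f_ n \in Lfun mu +oo%E) ->
    monotone_approx f_ (fun x => C * enorm x `^ gamma) ->
    forall t, 0 < t ->
      {ae mu, forall x, S t (f_ n) x @[n --> \oo] --> u t x}.

Definition selfsimilar_beta (s p gamma : R) : R :=
  (s * p + gamma * (2 - p))^-1.

Definition selfsimilar_profile S (s p C gamma : R) (F : E -> R) : Prop :=
  let beta := selfsimilar_beta s p gamma in
  continuous F /\
  minimal_solution S C gamma
    (fun t x => t `^ (gamma * beta) * F (t `^ (- beta) *: x)).

End fractional_p_laplacian.

(* Main.v *)
Require Import Defs.
From HB Require Import structures.
From mathcomp Require Import all_boot all_order all_algebra.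
From mathcomp Require Import all_classical all_reals all_analysis.
From mathcomp Require Import measurable_realfun ess_sup_inf ring lra.

Set Implicit Arguments.
Unset Strict Implicit.
Unset Printing Implicit Defensive.
Import Order.TTheory GRing.Theory Num.Theory.
Import numFieldNormedType.Exports.

Local Open Scope classical_set_scope.
Local Open Scope ring_scope.

(** The critical exponent [gamma1 = s p / (p - 1)] is the one for which the
    nonlocal operator diverges logarithmically at infinity: a value [C |y|^gamma1]
    at distance [|y|] pulls up the solution near the origin at the rate
    [|y|^(gamma1 (p - 1)) / |y|^(N + s p) = |y|^(-N)], so that each dyadic scale
    contributes the same amount.  It remains to see that the data persist at
    large scales for a fixed time, and that their pull makes the solution large
    everywhere on a ball.

    The semigroup is the limit of the iterates [V_k] of the resolvents of the
    subdifferential of [J], and everything is proved for the iterates, from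
    three convexity facts only.

    Comparison ([subdiff_comparison]).  Since [J (max v f) + J (min v f) <=
    J v + J f], testing the subgradient inequalities of [v] and [f] with their
    maximum and minimum compares them.  The gain in this inequality when [v] is
    very large at some distance is how the far field acts.

    Persistence ([iterates_persistence], [cube_persistence]).  Testing with a
    function [w] gives [|V_k - w|^2 <= |f - w|^2 + 2 k h J w].  On a cube of side
    [r] at distance [r] from the origin, and with [w] a scaled copy of a function
    of finite energy close to the indicator of the unit cube, the last term is
    negligible when [r] is large; so the iterates keep a value of order
    [r^gamma1] on a fixed proportion of the cube.

    Barrier ([barrier_exists], [barrier_step], [iterates_barrier]).  Let [eta] be
    the resolvent of the indicator of a unit cube [U] with step [1 / k].  It has
    the subgradient [k (1_U - eta)].  Hence [m(t) eta] with [m' = k m^(p - 1)],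
    [m(0) = 0], is a subsolution outside [U], and inside [U] the pull of enough
    large cubes makes it one.  So [V_n >= m eta], with [m] as large as desired
    since [k] is free.  Applying this to all translates of [eta] and averaging
    over the translations ([ae_ge_of_translates]) replaces [eta] by the constant
    [1/2], because [eta >= 1/2] on a set of positive measure.

    The outcome is [uniform_lower_bound]: for given [M], [L] and a compact
    interval of positive times, there are finitely many cubes such that any
    nonnegative datum which is at least [C r^gamma1] on them, up to sets of small
    measure, has a solution at least [M] almost everywhere on a ball of radius
    [L].  Monotone approximations of [C |x|^gamma1] eventually satisfy this
    hypothesis, which gives the four statements of divergence.  So do the
    truncations of [C |x|^gamma] when [gamma] is close to [gamma1], with the same
    cubes relative to any center because the cubes are placed on the side of the
    center that leads away from the origin; this gives the uniform divergence of
    the profiles. *)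

(** * Convexity of powers *)

Section power_inequalities.
Context {R : realType}.
Implicit Types p x y m : R.

(** The graph of the power lies above its tangents; this is Young's inequality
    for the conjugate exponents [p] and [p / (p - 1)]. *)
Lemma powR_tangent p x y : 1 < p -> 0 <= x -> 0 <= y ->
  x `^ p + p * x `^ (p - 1) * (y - x) <= y `^ p.
Proof.
move=> p1 x0 y0; have p0 : 0 < p by rewrite (lt_trans _ p1).
have pB0 : 0 < p - 1 by rewrite subr_gt0.
have := @conjugate_powR R y (x `^ (p - 1)) p (p / (p - 1)) y0 (powR_ge0 _ _) p0.
rewrite divr_gt0// => /(_ isT).
have -> : p^-1 + (p / (p - 1))^-1 = 1 by field; rewrite !gt_eqF.
move=> /(_ erefl); rewrite -powRrM [(p - 1) * _]mulrC divfK ?gt_eqF//.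
move=> H; have xE : x * x `^ (p - 1) = x `^ p by rewrite mulr_powRB1.
have {}H : p * (y * x `^ (p - 1)) <= y `^ p + (p - 1) * x `^ p.
  have -> : y `^ p + (p - 1) * x `^ p = p * (y `^ p / p + x `^ p / (p / (p - 1))).
    by field; rewrite !gt_eqF.
  by rewrite ler_pM2l.
have -> : x `^ p + p * x `^ (p - 1) * (y - x) =
    x `^ p + p * (y * x `^ (p - 1)) - p * (x * x `^ (p - 1)) by ring.
by rewrite xE; lra.
Qed.

Lemma normr_powR_convex p (l a b : R) : 1 <= p -> 0 <= l <= 1 ->
  `|l * a + (1 - l) * b| `^ p <= l * `|a| `^ p + (1 - l) * `|b| `^ p.
Proof.
move=> p1 /andP[l0 l1]; have l1' : 0 <= 1 - l by rewrite subr_ge0.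
have p0 : 0 <= p by rewrite (le_trans _ p1).
apply: (@le_trans _ _ ((l * `|a| + (1 - l) * `|b|) `^ p)).
  apply: ge0_ler_powR; rewrite ?nnegrE ?addr_ge0 ?mulr_ge0//.
  by rewrite (le_trans (ler_normD _ _))// !normrM (ger0_norm l0) (ger0_norm l1').
by apply: (convex_powR p1 (Itv01 l0 l1));
  rewrite inE/= in_itv/= normr_ge0.
Qed.

(** Convexity in the form in which two energies are compared: pulling two
    points towards each other, with fixed sum, lowers the sum of the powers. *)
Lemma normr_powR_exchange p (t1 t2 a : R) : 1 <= p -> t1 <= a <= t2 ->
  `|a| `^ p + `|t1 + t2 - a| `^ p <= `|t1| `^ p + `|t2| `^ p.
Proof.
move=> p1 /andP[t1a at2]; have [t12|t12] := eqVneq t1 t2.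
  have -> : a = t1 by lra.
  by rewrite t12 addrK.
have d0 : 0 < t2 - t1 by rewrite subr_gt0 lt_neqAle t12 (le_trans t1a).
pose l := (t2 - a) / (t2 - t1).
have l01 : 0 <= l <= 1.
  rewrite /l ler_pdivrMr// mul1r; apply/andP; split; last lra.
  by apply: divr_ge0; lra.
have l01' : 0 <= 1 - l <= 1 by lra.
have := normr_powR_convex t1 t2 p1 l01; have := normr_powR_convex t1 t2 p1 l01'.
have -> : l * t1 + (1 - l) * t2 = a by rewrite /l; field; rewrite gt_eqF.
have -> : (1 - l) * t1 + (1 - (1 - l)) * t2 = t1 + t2 - a.
  by rewrite /l; field; rewrite gt_eqF.
lra.
Qed.

(** Only the case where the two functions cross matters: there the differences
    on the left lie between those on the right and have the same sum. *)
Lemma normr_powR_submodular p (a a' b b' : R) : 1 <= p ->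
  `|Num.max a b - Num.max a' b'| `^ p + `|Num.min a b - Num.min a' b'| `^ p <=
  `|a - a'| `^ p + `|b - b'| `^ p.
Proof.
move=> p1; case: (leP a b) => ab; case: (leP a' b') => a'b'.
- by rewrite addrC.
- have := @normr_powR_exchange p (a - a') (b - b') (b - a') p1.
  have -> : a - a' + (b - b') - (b - a') = a - b' by ring.
  by apply; lra.
- have := @normr_powR_exchange p (b - b') (a - a') (a - b') p1.
  have -> : b - b' + (a - a') - (a - b') = b - a' by ring.
  by move=> H; rewrite [leRHS]addrC; apply: H; lra.
- by [].
Qed.

(** When [a'] lies far above, moving from [a] to [b] along the steep slope of
    [`|_ - a'| `^ p] gains more than the slope at distance [m] can cost. *)
Lemma normr_powR_submodular_gain p (a a' b b' m theta : R) : 1 < p ->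
  0 <= a -> a <= b -> b <= m -> b' <= m -> theta <= a' ->
  2 * m <= theta -> 2 * m `^ (p - 1) <= (theta / 2) `^ (p - 1) ->
  `|b - a'| `^ p + `|a - b'| `^ p + p / 2 * (theta / 2) `^ (p - 1) * (b - a) <=
  `|a - a'| `^ p + `|b - b'| `^ p.
Proof.
move=> p1 a0 ab bm b'm ta' mt mt'.
have p0 : 0 < p by rewrite (lt_trans _ p1).
have ab0 : 0 <= b - a by rewrite subr_ge0.
have H1 : `|b - a'| `^ p + p * (theta / 2) `^ (p - 1) * (b - a) <= `|a - a'| `^ p.
  have [ba' aa'] : b - a' <= 0 /\ a - a' <= 0 by split; lra.
  rewrite !ler0_norm//.
  apply: (le_trans _ (@powR_tangent p (- (b - a')) (- (a - a')) _ _ _)); [|lra..].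
  have -> : - (a - a') - - (b - a') = b - a by ring.
  rewrite lerD2l.
  by rewrite ler_wpM2r// ler_pM2l//; apply: ge0_ler_powR; rewrite ?nnegrE//; lra.
have H2 : `|a - b'| `^ p - p * m `^ (p - 1) * (b - a) <= `|b - b'| `^ p.
  have [ba|ab'] := leP b' a.
    rewrite (@le_trans _ _ (`|a - b'| `^ p))//.
      by rewrite gerBl mulr_ge0// mulr_ge0 ?powR_ge0// ltW.
    apply: ge0_ler_powR; rewrite ?nnegrE ?(ltW p0)//.
    by rewrite !ger0_norm; lra.
  have ab'0 : a - b' <= 0 by lra.
  rewrite [X in X `^ p - _]ler0_norm//.
  apply: (le_trans _ (@powR_tangent p (- (a - b')) `|b - b'| _ _ _)); [|lra| lra|exact: normr_ge0].
  rewrite lerD2l lerNl -mulrN.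
  apply: (@le_trans _ _ (p * (- (a - b')) `^ (p - 1) * (b - a))).
    rewrite ler_wpM2l ?mulr_ge0 ?powR_ge0 ?(ltW p0)//.
    by have := ler_norm (- (b - b')); rewrite normrN; lra.
  rewrite ler_wpM2r// ler_pM2l//.
  have pB : 0 <= p - 1 by lra.
  by apply: ge0_ler_powR; rewrite ?nnegrE//; lra.
have : p * m `^ (p - 1) * (b - a) <= p / 2 * (theta / 2) `^ (p - 1) * (b - a).
  by rewrite ler_wpM2r//; nra.
have E : p * (theta / 2) `^ (p - 1) * (b - a) = p / 2 * (theta / 2) `^ (p - 1) * (b - a)
  + p / 2 * (theta / 2) `^ (p - 1) * (b - a) by field.
rewrite E in H1; move: H1 H2.
set X := p / 2 * _ * _; set Y := p * _ * _; lra.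
Qed.

End power_inequalities.

(** * Affine changes of variables *)

Section integral_scaling.
Local Open Scope ereal_scope.
Context d (T : measurableType d) (R : realType).
Variable mu : {measure set T -> \bar R}.

Lemma ge0_integral_scaling (phi : T -> T) (k : {nonneg R}) (g : T -> \bar R) :
  measurable_fun setT phi ->
  (forall A, measurable A -> mu (phi @^-1` A) = k%:num%:E * mu A) ->
  measurable_fun setT g -> (forall x, 0 <= g x) ->
  \int[mu]_x g (phi x) = k%:num%:E * \int[mu]_x g x.
Proof.
move=> mphi phiE mg g0.
pose phi' : {mfun T >-> T} := HB.pack phi (isMeasurableFun.Build _ _ _ _ phi mphi).
have -> : \int[mu]_x g (phi x) = \int[pushforward mu phi']_x g x.
  by rewrite ge0_integral_pushforward// preimage_setT.
rewrite -ge0_integral_mscale//.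
by apply: eq_measure_integral => A mA _; exact: phiE.
Qed.

End integral_scaling.

Section affine_change_of_variables.
Context {R : realType}.
Local Open Scope ereal_scope.

Local Notation leb := (@lebesgue_measure R).

Lemma lebesgue_measure_affine (r c : R) (A : set (measurableTypeR R)) :
  (0 < r)%R -> measurable A ->
  leb ((fun x => r * x + c)%R @^-1` A) = (r^-1)%:E * leb A.
Proof.
move=> r0 mA.
have mphi : measurable_fun setT
    ((fun x => r * x + c)%R : measurableTypeR R -> measurableTypeR R).
  by apply: measurable_funD => //; exact: measurable_funM.
pose phi : measurableTypeR R -> measurableTypeR R := (fun x => r * x + c)%R.
pose m : {measure set (measurableTypeR R) -> \bar R} :=
  mscale (NngNum (ltW r0)) (pushforward leb phi).
suff -> : leb A = m mphi A.
  by rewrite /= /mscale/= muleA -EFinM mulVf ?gt_eqF// mul1e.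
apply: lebesgue_measure_unique => // _ [[a b]] _ <-.
transitivity (r%:E * leb (phi @^-1` `]a, b]%classic)); last by [].
have -> : phi @^-1` `]a, b]%classic = `](a - c) / r, (b - c) / r]%classic%R.
  apply/seteqP; split => x /=; rewrite /phi !in_itv/= ltr_pdivrMr// ler_pdivlMr//;
    by rewrite ltrBlDr lerBrDr (mulrC x).
rewrite !lebesgue_measure_itv/= !lte_fin ltr_pM2r ?invr_gt0// ltrD2r.
case: ifPn => _; last by rewrite mule0.
by rewrite -!EFinB -EFinM; congr EFin; field; rewrite gt_eqF.
Qed.

Definition affine_rV n (r : R) (c x : 'rV[R]_n) : 'rV[R]_n := (r *: x + c)%R.

Lemma measurable_affine_rV n (r : R) (c : 'rV[R]_n) :
  measurable_fun setT (affine_rV r c).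
Proof.
apply: measurable_fun_rVP => i; rewrite /affine_rV.
under eq_fun do rewrite mxE [X in (X + _)%R]mxE.
apply: measurable_funD => //; apply: measurable_funM => //.
exact: measurable_rV_coord.
Qed.

(** By induction on the dimension, slicing along the first coordinate. *)
Lemma lebesgue_rV_affine n (r : R) (c : 'rV[R]_n) (A : set 'rV[R]_n) :
  (0 < r)%R -> measurable A ->
  lebesgue_rV R n (affine_rV r c @^-1` A) = (r ^- n)%:E * lebesgue_rV R n A.
Proof.
move=> r0; elim: n c A => [|n IH] c A mA.
  rewrite expr0 invr1 mul1e; congr (lebesgue_rV R 0 _).
  by apply/seteqP; split => x; rewrite /= (thinmx0 x) [affine_rV _ _ _]thinmx0.
rewrite /= /cons_measure /pushforward.
have mB : measurable (@cons_rV R n @^-1` A).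
  by rewrite -[X in measurable X]setTI; exact: measurable_cons_rV.
pose B := @cons_rV R n @^-1` A; rewrite -/B in mB *.
rewrite [LHS]/product_measure1 [in RHS]/product_measure1.
pose g y := (lebesgue_rV R n \o xsection B) y.
have mg : measurable_fun setT g by exact: measurable_fun_xsection.
have g0 y : 0 <= g y by exact: measure_ge0.
transitivity (\int[leb]_x ((r ^- n)%:E * g (r * x + c ord0 ord0)%R)).
  apply: eq_integral => x _; rewrite /g /= -(IH (rsubmx (c : 'rV_(1 + n)))).
    congr (lebesgue_rV R n _); apply/seteqP.
    have E v : affine_rV r c (cons_rV (x, v)) =
        cons_rV (r * x + c ord0 ord0, affine_rV r (rsubmx (c : 'rV_(1 + n))) v)%R.
      rewrite -[LHS](@uncons_rVK R n); congr cons_rV; rewrite /uncons_rV/=.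
      congr pair; first by rewrite /affine_rV mxE [X in (X + _)%R]mxE (cons_rV0 (x, v)).
      apply/rowP => i; rewrite /affine_rV mxE mxE [X in (X + _)%R]mxE.
      have -> : rshift 1 i = lift ord0 i by exact/val_inj.
      by rewrite (cons_rVS (x, v))/= !mxE; congr (_ + c _ _)%R; exact/val_inj.
    by split => v; rewrite /xsection/= !inE /B/= E.
  exact: measurable_xsection.
rewrite ge0_integralZl//; last 2 first.
- apply: (measurableT_comp mg).
  by apply: measurable_funD => //; exact: measurable_funM.
- by rewrite lee_fin invr_ge0 exprn_ge0// ltW.
rewrite (@ge0_integral_scaling _ _ _ leb (fun x => r * x + c ord0 ord0)%R
  (NngNum (ltW (eqbRL (invr_gt0 r) r0))) g)//=.
- by rewrite muleA -EFinM exprSr invfM mulrC.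
- by apply: measurable_funD => //; exact: measurable_funM.
- by move=> C mC; exact: lebesgue_measure_affine.
Qed.

Lemma ge0_integral_affine n (r : R) (c : 'rV[R]_n) (g : 'rV[R]_n -> \bar R) :
  (0 < r)%R -> measurable_fun setT g -> (forall x, 0 <= g x) ->
  \int[lebesgue_rV R n]_x g (affine_rV r c x) =
  (r ^- n)%:E * \int[lebesgue_rV R n]_x g x.
Proof.
move=> r0 mg g0.
have k0 : (0 <= r ^- n)%R by rewrite invr_ge0 exprn_ge0// ltW.
apply: (@ge0_integral_scaling _ _ _ (lebesgue_rV R n) _ (NngNum k0)) => //.
  exact: measurable_affine_rV.
by move=> A mA; exact: lebesgue_rV_affine.
Qed.

Lemma ge0_integral_affine2 n (r : R) (c : 'rV[R]_n)
    (g : 'rV[R]_n * 'rV[R]_n -> \bar R) :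
  (0 < r)%R -> measurable_fun setT g -> (forall x, 0 <= g x) ->
  \int[lebesgue_rV R n \x lebesgue_rV R n]_z g (affine_rV r c z.1, affine_rV r c z.2) =
  (r ^- n * r ^- n)%:E * \int[lebesgue_rV R n \x lebesgue_rV R n]_z g z.
Proof.
move=> r0 mg g0; have mF := measurable_affine_rV r c.
have mg2 : measurable_fun setT (fun z => g (affine_rV r c z.1, affine_rV r c z.2)).
  apply: (measurableT_comp mg).
  by apply/measurable_fun_pairP; split; apply: (measurableT_comp mF);
    [exact: measurable_fst|exact: measurable_snd].
have k0 : (0 <= r ^- n)%R by rewrite invr_ge0 exprn_ge0// ltW.
have mI : measurable_fun setT (fun x => \int[lebesgue_rV R n]_y g (x, y)).
  exact: measurable_fun_fubini_tonelli_F.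
rewrite fubini_tonelli1//= fubini_tonelli1//= /fubini_F/=.
under eq_integral => x _.
  rewrite (@ge0_integral_affine n r c (fun y => g (affine_rV r c x, y)))//; last first.
    by apply: (measurableT_comp mg); exact: measurable_pair1.
  over.
rewrite ge0_integralZl//; last 2 first.
- exact: (measurableT_comp mI mF).
- by move=> x _; exact: integral_ge0.
- rewrite (@ge0_integral_affine n r c (fun x => \int[lebesgue_rV R n]_y g (x, y)))//.
  + by rewrite muleA -EFinM.
  + by move=> x; exact: integral_ge0.
Qed.

End affine_change_of_variables.

(** * Square-integrable functions *)

Section square_integrable.
Context d (T : measurableType d) (R : realType).
Variable mu : {measure set T -> \bar R}.
Implicit Types f g h : T -> R.
Local Notation L2 := (Lfun mu 2%:E).

Lemma Lfun_measurable r f : f \in Lfun mu r -> measurable_fun setT f.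
Proof. by rewrite inE => /andP[+ _]; rewrite inE. Qed.

Lemma measurable_EFin_sqr f : measurable_fun setT f ->
  measurable_fun setT (fun x => (f x ^+ 2)%:E).
Proof. by move=> mf; apply/measurable_EFinP; exact: measurable_funX. Qed.

Lemma Lfun2P f : f \in L2 <->
  measurable_fun setT f /\ (\int[mu]_x (f x ^+ 2)%:E < +oo)%E.
Proof.
split=> [lf|[mf foo]].
  split; first exact: Lfun_measurable lf.
  have /integrableP[_] := Lfun2_integrable_sqr lf.
  by under eq_integral do rewrite /= ger0_norm ?sqr_ge0//.
rewrite inE; apply/andP; split; rewrite inE//= /finite_norm.
rewrite unlock /Lnorm poweR_lty//.
under eq_integral do rewrite /= powR_mulrn// real_normK ?num_real//.
by [].
Qed.

Lemma Lfun2_le f g : measurable_fun setT g -> (forall x, `|g x| <= `|f x|) ->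
  f \in L2 -> g \in L2.
Proof.
move=> mg gf /Lfun2P[mf foo]; apply/Lfun2P; split => //.
apply: le_lt_trans foo; apply: ge0_le_integral => //.
- by move=> x _; rewrite lee_fin sqr_ge0.
- exact: measurable_EFin_sqr.
- exact: measurable_EFin_sqr.
by move=> x _; rewrite lee_fin -[leLHS]real_normK ?num_real//
  -[leRHS]real_normK ?num_real// lerXn2r ?nnegrE.
Qed.

Lemma Lfun2D f g : f \in L2 -> g \in L2 -> (fun x => f x + g x) \in L2.
Proof.
by move=> lf lg; exact: ((@Lfun_addr_closed _ _ _ mu 2%:E (lee1n 2)).2 f g lf lg).
Qed.

Lemma Lfun2N f : f \in L2 -> (fun x => - f x) \in L2.
Proof.
move=> lf; apply: (Lfun2_le _ _ lf) => [|x]; last by rewrite normrN.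
by apply: measurableT_comp => //; exact: Lfun_measurable lf.
Qed.

Lemma Lfun2B f g : f \in L2 -> g \in L2 -> (fun x => f x - g x) \in L2.
Proof. by move=> lf lg; apply: Lfun2D => //; exact: Lfun2N. Qed.

Lemma Lfun2Z (a : R) f : f \in L2 -> (fun x => a * f x) \in L2.
Proof.
move=> lf; have := Lfun_scale a (ler1n _ 2) lf.
by rewrite (_ : _ \o* _ = (fun x => a * f x))//; apply/funext => x /=; rewrite mulrC.
Qed.

Lemma Lfun2_norm f : f \in L2 -> (fun x => `|f x|) \in L2.
Proof.
move=> lf; apply: (Lfun2_le _ _ lf) => [|x]; last by rewrite normr_id.
by apply: measurableT_comp => //; exact: Lfun_measurable lf.
Qed.

Lemma Lfun2_max f g : f \in L2 -> g \in L2 -> (fun x => Num.max (f x) (g x)) \in L2.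
Proof.
move=> lf lg; apply: Lfun2_le (Lfun2D (Lfun2_norm lf) (Lfun2_norm lg)).
  by apply: measurable_maxr; [exact: Lfun_measurable lf|exact: Lfun_measurable lg].
move=> x; rewrite [leRHS]ger0_norm; last exact: addr_ge0.
by case: (leP (f x) (g x)) => _; rewrite ?lerDl ?lerDr.
Qed.

Lemma Lfun2_min f g : f \in L2 -> g \in L2 -> (fun x => Num.min (f x) (g x)) \in L2.
Proof.
move=> lf lg; apply: Lfun2_le (Lfun2D (Lfun2_norm lf) (Lfun2_norm lg)).
  by apply: measurable_minr; [exact: Lfun_measurable lf|exact: Lfun_measurable lg].
move=> x; rewrite [leRHS]ger0_norm; last exact: addr_ge0.
by case: (leP (f x) (g x)) => _; rewrite ?lerDl ?lerDr.
Qed.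

Lemma Lfun2_0 : (fun=> 0) \in L2.
Proof.
by apply/Lfun2P; split => //; rewrite integral0_eq// => x _; rewrite expr0n.
Qed.

Lemma Lfun2_indic (A : set T) : measurable A -> (mu A < +oo)%E -> (\1_A : T -> R) \in L2.
Proof.
move=> mA Aoo; apply/Lfun2P; split; first exact: measurable_indic.
rewrite (eq_integral (EFin \o \1_A)) ?integral_indic// ?setIT// => x _ /=.
by rewrite indicE; case: (x \in A); rewrite ?expr1n ?expr0n.
Qed.

Lemma integrable_mul2 f g : f \in L2 -> g \in L2 ->
  mu.-integrable setT (EFin \o (fun x => f x * g x)).
Proof. by move=> lf lg; apply/Lfun1_integrable; exact: Lfun2_mul_Lfun1. Qed.

Lemma integrable_sqr2 f : f \in L2 -> mu.-integrable setT (EFin \o (fun x => f x ^+ 2)).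
Proof. exact: Lfun2_integrable_sqr. Qed.

Lemma EFin_Rintegral D f : measurable D -> mu.-integrable D (EFin \o f) ->
  (\int[mu]_(x in D) f x)%:E = (\int[mu]_(x in D) (f x)%:E)%E.
Proof. by move=> mD fi; rewrite /Rintegral fineK//; exact: integrable_fin_num. Qed.

Lemma ae_le_Rintegral f g :
  mu.-integrable setT (EFin \o f) -> mu.-integrable setT (EFin \o g) ->
  {ae mu, forall x, f x <= g x} -> \int[mu]_x f x <= \int[mu]_x g x.
Proof.
move=> fi gi fg; rewrite -subr_ge0 -RintegralB//.
have mgf : measurable_fun setT (fun x => (g x - f x)%:E).
  by case/integrableP: (integrableB measurableT gi fi).
rewrite /Rintegral fine_ge0// (@ae_eq_integral _ _ _ mu setT
  (fun x => (Num.max (g x - f x) 0)%:E))//.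
- by apply: integral_ge0 => x _; rewrite lee_fin le_max lexx orbT.
- apply/measurable_EFinP; apply: measurable_maxr => //; exact/measurable_EFinP.
- by apply: filterS fg => x fgx _; rewrite max_l// subr_ge0.
Qed.

Lemma sqr_Rintegral_le0 f : f \in L2 -> \int[mu]_x (f x ^+ 2) <= 0 ->
  {ae mu, forall x, f x = 0}.
Proof.
move=> lf f0; have mf := Lfun_measurable lf.
have : (\int[mu]_x `|(f x ^+ 2)%:E| = 0)%E.
  under eq_integral do rewrite /= ger0_norm ?sqr_ge0//.
  apply/eqP; rewrite eq_le integral_ge0 ?andbT; last by move=> x _; rewrite lee_fin sqr_ge0.
  by rewrite -EFin_Rintegral//; exact: integrable_sqr2.
move/(ae_eq_integral_abs _ measurableT (measurable_EFin_sqr mf)).1.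
by apply: filterS => x /(_ I)[] /eqP; rewrite sqrf_eq0 => /eqP.
Qed.

Lemma sqr_integral_triangle f g h : measurable_fun setT f -> measurable_fun setT g ->
  measurable_fun setT h ->
  (\int[mu]_x ((f x - h x) ^+ 2)%:E <=
   2%:E * (\int[mu]_x ((f x - g x) ^+ 2)%:E + \int[mu]_x ((g x - h x) ^+ 2)%:E))%E.
Proof.
move=> mf mg mh.
have mB (u v : T -> R) : measurable_fun setT u -> measurable_fun setT v ->
    measurable_fun setT (fun x => ((u x - v x) ^+ 2)%:E : \bar R).
  by move=> mu_ mv; apply: measurable_EFin_sqr; exact: measurable_funB.
have sq0 (u v : T -> R) x : (0 <= ((u x - v x : R) ^+ 2)%:E)%E by rewrite lee_fin sqr_ge0.
rewrite -ge0_integralD//; [|exact: mB..].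
rewrite -ge0_integralZl//; last 2 first.
- by apply: emeasurable_funD; exact: mB.
- by move=> x _; rewrite adde_ge0.
apply: ge0_le_integral => //.
- exact: mB.
- by apply: measurable_funeM; apply: emeasurable_funD; exact: mB.
move=> x _; rewrite -EFinD -EFinM lee_fin.
have := sqr_ge0 ((f x - g x) - (g x - h x)); nra.
Qed.

(** Chebyshev's inequality, which turns closeness in [L^2] into smallness of
    exceptional sets. *)
Lemma sqr_chebyshev f (A : set T) (a : R) : measurable_fun setT f -> measurable A ->
  (forall x, A x -> a <= f x ^+ 2) -> 0 <= a ->
  (a%:E * mu A <= \int[mu]_x (f x ^+ 2)%:E)%E.
Proof.
move=> mf mA fa a0; rewrite -integral_cst//.
apply: (@le_trans _ _ (\int[mu]_(x in A) (f x ^+ 2)%:E)%E).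
  apply: ge0_le_integral => //.
  by apply: measurable_funTS; exact: measurable_EFin_sqr.
apply: ge0_subset_integral => //; first exact: measurable_EFin_sqr.
by move=> x _; rewrite lee_fin sqr_ge0.
Qed.

(** The positive part of [g - u] is dominated by [`|u_ n - u|] for large [n]. *)
Lemma ae_le_sqr_lim (g u : T -> R) (u_ : nat -> T -> R) :
  measurable_fun setT g -> measurable_fun setT u ->
  (forall n, measurable_fun setT (u_ n)) ->
  (\forall n \near \oo, {ae mu, forall x, g x <= u_ n x}) ->
  (\int[mu]_x ((u_ n x - u x) ^+ 2)%:E)%E @[n --> \oo] --> 0%E ->
  {ae mu, forall x, g x <= u x}.
Proof.
move=> mg mu_ mun gun un0.
pose z x := Num.max (g x - u x) 0.
have mz : measurable_fun setT z.
  by apply: measurable_maxr => //; exact: measurable_funB.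
have zn : \forall n \near \oo,
    (\int[mu]_x (z x ^+ 2)%:E <= \int[mu]_x ((u_ n x - u x) ^+ 2)%:E)%E.
  apply: filterS gun => n gun; apply: ae_ge0_le_integral => //.
  - by move=> x _; rewrite lee_fin sqr_ge0.
  - exact: measurable_EFin_sqr.
  - by move=> x _; rewrite lee_fin sqr_ge0.
  - by apply: measurable_EFin_sqr; exact: measurable_funB.
  apply: filterS gun => x gx _; rewrite lee_fin /z.
  case: (leP (g x - u x) 0) => gu; first by rewrite expr0n sqr_ge0.
  by rewrite ler_sqr ?nnegrE; lra.
have z0 : (\int[mu]_x (z x ^+ 2)%:E = 0)%E.
  apply/eqP; rewrite eq_le integral_ge0 ?andbT; last by move=> x _; rewrite lee_fin sqr_ge0.
  exact: cvge_ge zn un0.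
have lz : z \in L2 by apply/Lfun2P; rewrite z0.
have /sqr_Rintegral_le0 : \int[mu]_x (z x ^+ 2) <= 0 by rewrite /Rintegral z0.
move=> /(_ lz); apply: filterS => x; rewrite /z.
by case: (leP (g x - u x) 0) => [|gu /eqP]; [rewrite subr_le0|rewrite gt_eqF].
Qed.

Lemma dist_Lq2_sqr f g : measurable_fun setT f -> measurable_fun setT g ->
  (\int[mu]_x ((f x - g x) ^+ 2)%:E)%E = ('N[mu]_(2%:E)[EFin \o (f \- g)%R] `^ 2)%E.
Proof.
move=> mf mg; rewrite powR_Lnorm//; apply: eq_integral => x _ /=.
by rewrite powR_mulrn// real_normK ?num_real.
Qed.

End square_integrable.

(** * Energy and comparison of subgradients *)

Section energy.
Context {R : realType} {N : nat}.
Variables s p : R.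
Local Notation E := 'rV[R]_N.
Local Notation mu := (lebesgue_rV R N).
Local Notation L2 := (Lfun mu 2%:E).
Local Notation J := (@gagliardo R N s p).
Implicit Types (f g u v w xi chi : E -> R) (h : R).

Lemma measurable_enorm : measurable_fun setT (@enorm R N).
Proof.
rewrite /enorm; apply: measurableT_comp.
  by apply: continuous_measurable_fun; exact: sqrt_continuous.
by apply: measurable_sum => i; apply: measurable_funX; exact: measurable_rV_coord.
Qed.

Lemma measurable_subrV : measurable_fun setT (fun z : E * E => z.1 - z.2).
Proof.
apply: measurable_fun_rVP => i; under eq_fun do rewrite mxE [X in _ + X]mxE.
by apply: measurable_funB; apply: (measurableT_comp (measurable_rV_coord i));
  [exact: measurable_fst|exact: measurable_snd].
Qed.

Definition energy_density u (z : E * E) : R :=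
  `|u z.1 - u z.2| `^ p / enorm (z.1 - z.2) `^ (N%:R + s * p).

Lemma energy_density_ge0 u z : 0 <= energy_density u z.
Proof. by rewrite divr_ge0 ?powR_ge0. Qed.

Lemma measurable_pair_diff u : measurable_fun setT u ->
  measurable_fun setT (fun z : E * E => u z.1 - u z.2).
Proof.
move=> mu_; apply: measurable_funB; apply: (measurableT_comp mu_);
  [exact: measurable_fst|exact: measurable_snd].
Qed.

Lemma measurable_energy_density u : measurable_fun setT u ->
  measurable_fun setT (energy_density u).
Proof.
move=> mu_; rewrite /energy_density; under eq_fun do rewrite -powRN.
apply: measurable_funM.
  apply: (measurableT_comp (measurable_powR _)); apply: measurableT_comp => //.
  exact: measurable_pair_diff.
apply: (measurableT_comp (measurable_powR _)).
exact: (measurableT_comp measurable_enorm measurable_subrV).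
Qed.

Lemma gagliardoE u :
  J u = (((2 * p)^-1)%:E * \int[mu \x mu]_z (energy_density u z)%:E)%E.
Proof. by []. Qed.

Hypothesis p1 : 1 < p.

Let p0 : 0 < p. Proof. exact: lt_trans p1. Qed.
Let c0 : 0 <= (2 * p)^-1. Proof. by rewrite invr_ge0 mulr_ge0// ltW. Qed.

Lemma gagliardo_ge0 u : (0 <= J u)%E.
Proof.
by rewrite gagliardoE mule_ge0 ?lee_fin ?integral_ge0// => z _;
  rewrite lee_fin energy_density_ge0.
Qed.

Lemma gagliardo0 : J (fun=> 0) = 0%E.
Proof.
rewrite gagliardoE integral0_eq ?mule0// => z _.
by rewrite /energy_density subrr normr0 powR0 ?mul0r// gt_eqF.
Qed.

Lemma subdiff0 : @subdiff R N s p (fun=> 0) (fun=> 0).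
Proof.
split; try exact: Lfun2_0.
move=> w _; rewrite gagliardo0 add0e /Rintegral integral0_eq ?gagliardo_ge0//.
by move=> x _; rewrite mul0r.
Qed.

Lemma subdiff_fin v xi : subdiff s p v xi -> (J v < +oo)%E.
Proof.
move=> [lv lxi /(_ _ (Lfun2_0 _))]; rewrite gagliardo0.
by case: (J v) => [r _| |]//; exact: ltry.
Qed.

(** [G] is a gain of the truncation: it is zero in the comparison principle,
    and it carries the effect of the far field in the barrier argument. *)
Lemma gagliardo_max_min v f (G : E * E -> R) :
  measurable_fun setT v -> measurable_fun setT f -> measurable_fun setT G ->
  (forall z, 0 <= G z) ->
  (forall z, energy_density (fun x => Num.max (v x) (f x)) z +
             energy_density (fun x => Num.min (v x) (f x)) z + G z <=
             energy_density v z + energy_density f z) ->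
  (J (fun x => Num.max (v x) (f x)) + J (fun x => Num.min (v x) (f x)) +
    ((2 * p)^-1)%:E * \int[mu \x mu]_z (G z)%:E <= J v + J f)%E.
Proof.
move=> mv mf mG G0 H.
have mE u : measurable_fun setT u ->
    measurable_fun setT (fun z => (energy_density u z)%:E).
  by move=> mu_; apply/measurable_EFinP; exact: measurable_energy_density.
have mM := measurable_maxr mv mf; have mm := measurable_minr mv mf.
have mGE : measurable_fun setT (fun z => (G z)%:E) by exact/measurable_EFinP.
have e0 u z : setT z -> (0 <= (energy_density u z)%:E)%E.
  by move=> _; rewrite lee_fin energy_density_ge0.
have G0' z : setT z -> (0 <= (G z)%:E)%E by rewrite lee_fin.
have i0 (k : E * E -> R) : (forall z, 0 <= k z) -> (0 <= \int[mu \x mu]_z (k z)%:E)%E.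
  by move=> k0; apply: integral_ge0 => z _; rewrite lee_fin.
have e0' := energy_density_ge0.
have iE u : (0 <= \int[mu \x mu]_z (energy_density u z)%:E)%E by exact: i0.
have iEE u w : (0 <= \int[mu \x mu]_z (energy_density u z)%:E +
    \int[mu \x mu]_z (energy_density w z)%:E)%E by rewrite adde_ge0.
rewrite !gagliardoE -(ge0_muleDr _ (iE v) (iE f)) -ge0_muleDr// -ge0_muleDr ?i0//.
rewrite lee_wpmul2l ?lee_fin//.
rewrite -!ge0_integralD//; try exact: mE; try exact: e0.
- apply: ge0_le_integral => //.
  + by move=> z _; rewrite !adde_ge0 ?e0// G0'.
  + by do 2 (apply: emeasurable_funD => //); exact: mE.
  + by apply: emeasurable_funD; exact: mE.
  + by move=> z _; rewrite -!EFinD lee_fin.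
- by move=> z _; rewrite adde_ge0 ?e0.
- by apply: emeasurable_funD; exact: mE.
Qed.

(** The engine of all the comparisons below.  Testing the two subgradient
    inequalities with the maximum and the minimum of [v] and [f], the energies
    cancel up to the gain [G]; no equation is ever differentiated. *)
Lemma subdiff_comparison v xi f chi (G : E * E -> R) :
  subdiff s p v xi -> subdiff s p f chi -> measurable_fun setT G ->
  (forall z, 0 <= G z) ->
  (forall z, energy_density (fun x => Num.max (v x) (f x)) z +
             energy_density (fun x => Num.min (v x) (f x)) z + G z <=
             energy_density v z + energy_density f z) ->
  ((\int[mu]_x ((xi x - chi x) * Num.max (f x - v x) 0))%:E +
    ((2 * p)^-1)%:E * \int[mu \x mu]_z (G z)%:E <= 0)%E.
Proof.
move=> sv sf mG G0 H; have [lv lxi Hv] := sv; have [lf lchi Hf] := sf.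
have := gagliardo_max_min (Lfun_measurable lv) (Lfun_measurable lf) mG G0 H.
have lM := Lfun2_max lv lf; have lm := Lfun2_min lv lf.
have := Hv _ lM; have := Hf _ lm.
have := subdiff_fin sv; have := subdiff_fin sf.
have := gagliardo_ge0 v; have := gagliardo_ge0 f.
have -> : \int[mu]_x ((xi x - chi x) * Num.max (f x - v x) 0) =
    \int[mu]_x (xi x * (Num.max (v x) (f x) - v x)) +
    \int[mu]_x (chi x * (Num.min (v x) (f x) - f x)).
  rewrite -RintegralD//; try by apply: integrable_mul2 => //; exact: Lfun2B.
  apply: eq_Rintegral => x _.
  case: (leP (v x) (f x)) => vf.
    by rewrite max_l ?subr_ge0//; ring.
  by rewrite max_r ?subr_le0 ?ltW//; ring.
set A := Rintegral _ _ _; set B := Rintegral _ _ _; set I := (_ * integral _ _ _)%E.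
have I0 : (0 <= I)%E by rewrite mule_ge0 ?lee_fin ?integral_ge0// => z _; rewrite lee_fin.
case: (J v) => [a| |]//; case: (J f) => [b| |]// _ _ _ _.
have := gagliardo_ge0 (fun x => Num.max (v x) (f x)).
have := gagliardo_ge0 (fun x => Num.min (v x) (f x)).
case: (J _) => [m| |]//; case: (J _) => [M| |]//; case: I I0 => [i| |]//.
rewrite !lee_fin; lra.
Qed.

Lemma energy_density_submodular v f z :
  energy_density (fun x => Num.max (v x) (f x)) z +
  energy_density (fun x => Num.min (v x) (f x)) z <=
  energy_density v z + energy_density f z.
Proof.
rewrite /energy_density -!mulrDl ler_wpM2r ?invr_ge0 ?powR_ge0//.
exact/normr_powR_submodular/ltW.
Qed.

(** The accretivity estimate behind the order: the positive part of [f - v] is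
    the test function, and its square is what remains. *)
Lemma subdiff_le v xi f chi (h : R) : 0 < h ->
  subdiff s p v xi -> subdiff s p f chi ->
  {ae mu, forall x, v x < f x -> (f x - v x) / h <= xi x - chi x} ->
  {ae mu, forall x, f x <= v x}.
Proof.
move=> h0 sv sf H; have [lv lxi _] := sv; have [lf lchi _] := sf.
have := @subdiff_comparison v xi f chi (fun=> 0) sv sf (measurable_cst _) (fun=> lexx _).
have E0 z : energy_density (fun x => Num.max (v x) (f x)) z +
    energy_density (fun x => Num.min (v x) (f x)) z + 0 <=
    energy_density v z + energy_density f z.
  by rewrite addr0; exact: energy_density_submodular.
move=> /(_ E0); rewrite integral0 mule0 adde0 lee_fin => I0.
have lz : (fun x => Num.max (f x - v x) 0) \in L2.
  by apply: Lfun2_max; [exact: Lfun2B|exact: Lfun2_0].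
suff : \int[mu]_x (Num.max (f x - v x) 0 ^+ 2) <= 0.
  move=> /(sqr_Rintegral_le0 lz); apply: filterS => x.
  by case: (leP (f x - v x) 0) => [|fv /eqP]; [rewrite subr_le0|rewrite gt_eqF].
rewrite -(pmulr_rle0 _ (eqbRL (invr_gt0 h) h0)) -RintegralZl//; last first.
  exact: integrable_sqr2.
apply: le_trans I0; apply: ae_le_Rintegral.
- have := integrable_mul2 (Lfun2Z h^-1 lz) lz; congr (integrable _ _ _).
  by apply/funext => x /=; rewrite expr2 mulrA.
- by apply: integrable_mul2 => //; exact: Lfun2B.
apply: filterS H => x; case: (leP (f x - v x) 0) => [|fv].
  by rewrite expr0n/= !mulr0.
rewrite -subr_gt0 => /(_ fv) H; rewrite expr2 mulrA ler_wpM2r ?(ltW fv)//.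
by rewrite mulrC.
Qed.

Lemma resolvent_le h f g v w : 0 < h ->
  resolvent s p h f v -> resolvent s p h g w ->
  {ae mu, forall x, f x <= g x} -> {ae mu, forall x, v x <= w x}.
Proof.
move=> h0 rv rw fg; apply: (subdiff_le h0 rw rv); apply: filterS fg => x fg _.
by rewrite -mulrBl ler_wpM2r ?invr_ge0 ?(ltW h0)//; lra.
Qed.

Lemma resolvent0 h : @resolvent R N s p h (fun=> 0) (fun=> 0).
Proof.
rewrite /resolvent (_ : (fun _ => _) = (fun=> 0)); first exact: subdiff0.
by apply/funext => x; rewrite subrr mul0r.
Qed.

Lemma resolvent_ge0 h f v : 0 < h -> resolvent s p h f v ->
  {ae mu, forall x, 0 <= f x} -> {ae mu, forall x, 0 <= v x}.
Proof. by move=> h0 rv; exact: resolvent_le h0 (resolvent0 h) rv. Qed.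

(** Testing with [w] itself: a step can move away from [w] only as fast as the
    energy of [w] allows, whatever the datum [f]. *)
Lemma resolvent_persistence h f v w : 0 < h -> f \in L2 -> w \in L2 ->
  resolvent s p h f v ->
  (\int[mu]_x ((v x - w x) ^+ 2)%:E <=
   \int[mu]_x ((f x - w x) ^+ 2)%:E + (2 * h)%:E * J w)%E.
Proof.
move=> h0 lf lw [lv lxi /(_ w lw) H].
have lvw := Lfun2B lv lw; have lfw := Lfun2B lf lw.
have lwv := Lfun2B lw lv; have lfv := Lfun2B lf lv.
rewrite -!EFin_Rintegral//; try exact: integrable_sqr2.
set I := Rintegral _ _ _ in H.
have HI : (I%:E <= J w)%E.
  apply: le_trans H; rewrite leeDr//; exact: gagliardo_ge0.
apply: le_trans (leeD2l _ (lee_wpmul2l _ HI)); last by rewrite lee_fin mulr_ge0// ltW.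
rewrite -EFinM -EFinD lee_fin /I -RintegralZl//; last exact: integrable_mul2.
have i1 : mu.-integrable setT (EFin \o (fun x => (2 * h) * ((f x - v x) / h * (w x - v x)))).
  exact: (integrableZl measurableT (2 * h) (integrable_mul2 lxi lwv)).
rewrite -RintegralD//; last exact: integrable_sqr2.
apply: le_Rintegral => //; first exact: integrable_sqr2.
  exact: (integrableD measurableT (integrable_sqr2 lfw) i1).
move=> x _; have -> : 2 * h * ((f x - v x) / h * (w x - v x)) =
   2 * ((f x - v x) * (w x - v x)) by field; rewrite gt_eqF.
by have := sqr_ge0 (f x - v x); nra.
Qed.

End energy.

(** * Scaling and translation of the energy *)

Section energy_scaling.
Context {R : realType} {N : nat}.
Variables s p : R.
Local Notation E := 'rV[R]_N.
Local Notation mu := (lebesgue_rV R N).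
Local Notation L2 := (Lfun mu 2%:E).
Local Notation J := (@gagliardo R N s p).
Implicit Types (f g u v w xi chi : E -> R).

Lemma EFin_mulMA (a b : R) (x : \bar R) : (a%:E * (b%:E * x) = (a * b)%:E * x)%E.
Proof. by rewrite muleA EFinM. Qed.

Lemma enormZ (r : R) (x : E) : 0 <= r -> enorm (r *: x) = r * enorm x.
Proof.
move=> r0; rewrite /enorm.
under eq_bigr do rewrite mxE exprMn.
by rewrite -mulr_sumr sqrtrM ?sqr_ge0// sqrtr_sqr ger0_norm.
Qed.

Lemma gagliardoZ (k : R) u : 0 < p -> 0 <= k -> measurable_fun setT u ->
  J (fun x => k * u x) = ((k `^ p)%:E * J u)%E.
Proof.
move=> p0 k0 mu_; rewrite !gagliardoE.
have -> : (\int[mu \x mu]_z (energy_density s p (fun x => (k * u x)%R) z)%:E =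
    (k `^ p)%:E * \int[mu \x mu]_z (energy_density s p u z)%:E)%E.
  rewrite -ge0_integralZl//.
  - apply: eq_integral => z _; rewrite -EFinM /energy_density; congr (_%:E).
    by rewrite -mulrBr normrM (ger0_norm k0) powRM// mulrA.
  - by apply/measurable_EFinP; exact: measurable_energy_density.
  - by move=> z _; rewrite lee_fin energy_density_ge0.
  - by rewrite lee_fin powR_ge0.
by rewrite muleCA.
Qed.

Lemma gagliardo_affine (r : R) (c : E) u : 0 < r -> measurable_fun setT u ->
  J (u \o affine_rV r c) = ((r `^ (N%:R + s * p) * (r ^- N * r ^- N))%:E * J u)%E.
Proof.
move=> r0 mu_; rewrite !gagliardoE.
have rp0 : (0 <= (r `^ (N%:R + s * p))%:E)%E by rewrite lee_fin powR_ge0.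
have mEu : measurable_fun setT (fun z => (energy_density s p u z)%:E).
  by apply/measurable_EFinP; exact: measurable_energy_density.
have -> : (\int[mu \x mu]_z (energy_density s p (u \o affine_rV r c) z)%:E =
    (r `^ (N%:R + s * p) * (r ^- N * r ^- N))%:E *
    \int[mu \x mu]_z (energy_density s p u z)%:E)%E.
  pose g (z : E * E) := (energy_density s p u z)%:E.
  have g0 z : (0 <= g z)%E by rewrite lee_fin energy_density_ge0.
  transitivity (\int[mu \x mu]_z
      ((r `^ (N%:R + s * p))%:E * g (affine_rV r c z.1, affine_rV r c z.2)))%E.
    apply: eq_integral => z _; rewrite -EFinM /energy_density/=; congr (_%:E).
    have -> : affine_rV r c z.1 - affine_rV r c z.2 = r *: (z.1 - z.2).
      by rewrite /affine_rV scalerBr opprD addrACA subrr addr0.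
    rewrite enormZ ?(ltW r0)// powRM ?(ltW r0)// ?sqrtr_ge0//.
    by rewrite [X in _ = _ * (_ * X)]invfM mulrCA mulVKf// gt_eqF// powR_gt0.
  have mg2 : measurable_fun setT (fun z : E * E => g (affine_rV r c z.1, affine_rV r c z.2)).
    have mF := measurable_affine_rV r c.
    apply: (measurableT_comp mEu).
    by apply/measurable_fun_pairP; split; apply: (measurableT_comp mF);
      [exact: measurable_fst|exact: measurable_snd].
  have Zl := @ge0_integralZl _ _ _ (mu \x mu)%E _ measurableT _ mg2
    _ (fun z _ => g0 _) rp0.
  have A2 := @ge0_integral_affine2 R N r c g r0 mEu g0.
  apply: (etrans Zl); apply: (etrans (congr1 (mule (r `^ (N%:R + s * p))%:E) A2)).
  exact: EFin_mulMA.
by rewrite muleCA.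
Qed.

Lemma sqr_integral_affine (r : R) (c : E) u : 0 < r -> measurable_fun setT u ->
  (\int[mu]_x (u (affine_rV r c x) ^+ 2)%:E =
   (r ^- N)%:E * \int[mu]_x (u x ^+ 2)%:E)%E.
Proof.
move=> r0 mu_; rewrite -(@ge0_integral_affine _ _ r c (fun x => (u x ^+ 2)%:E))//.
- exact: measurable_EFin_sqr.
- by move=> x; rewrite lee_fin sqr_ge0.
Qed.

Lemma Lfun2_affine (r : R) (c : E) u : 0 < r -> u \in L2 -> u \o affine_rV r c \in L2.
Proof.
move=> r0 /Lfun2P[mu_ uoo]; apply/Lfun2P; split.
  by apply: measurableT_comp => //; exact: measurable_affine_rV.
rewrite [ltLHS](sqr_integral_affine c r0 mu_).
by rewrite lte_mul_pinfty// ?lee_fin ?invr_ge0 ?exprn_ge0 ?ltW.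
Qed.

Definition translate (b : E) u : E -> R := u \o affine_rV 1 b.

Lemma translateE b u x : translate b u x = u (x + b).
Proof. by rewrite /translate /affine_rV/= scale1r. Qed.

Lemma translateK b u : translate b (translate (- b) u) = u.
Proof. by apply/funext => x; rewrite !translateE addrK. Qed.

Lemma gagliardo_translate b u : measurable_fun setT u -> J (translate b u) = J u.
Proof.
by move=> mu_; rewrite gagliardo_affine// powR1 expr1n invr1 !mul1r mul1e.
Qed.

Lemma Lfun2_translate b u : u \in L2 -> translate b u \in L2.
Proof. exact: Lfun2_affine. Qed.

Lemma Rintegral_translate b u : measurable_fun setT u ->
  \int[mu]_x translate b u x = \int[mu]_x u x.
Proof.
move=> mu_; rewrite /Rintegral integralE [in RHS]integralE.
have mE : measurable_fun setT (EFin \o u) by exact/measurable_EFinP.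
have H (g : E -> \bar R) : measurable_fun setT g -> (forall x, 0 <= g x)%E ->
    (\int[mu]_x g (affine_rV 1 b x) = \int[mu]_x g x)%E.
  by move=> mg g0; rewrite ge0_integral_affine// expr1n invr1 mul1e.
congr (fine (_ - _)%E).
  rewrite -(H (EFin \o u)^\+%E (measurable_funepos mE) (funepos_ge0 _)).
  by apply: eq_integral => x _; rewrite !funeposE.
rewrite -(H (EFin \o u)^\-%E (measurable_funeneg mE) (funeneg_ge0 _)).
by apply: eq_integral => x _; rewrite !funenegE.
Qed.

Lemma subdiff_translate b v xi : subdiff s p v xi ->
  subdiff s p (translate b v) (translate b xi).
Proof.
move=> [lv lxi H]; split; [exact: Lfun2_translate..|move=> w lw].
have lw' := Lfun2_translate (- b) lw.
have := H _ lw'; rewrite -(gagliardo_translate b (Lfun_measurable lv)).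
rewrite -(gagliardo_translate b (Lfun_measurable lw')) translateK.
rewrite -(@Rintegral_translate b); last first.
  by apply: measurable_funM; [exact: Lfun_measurable lxi|
    apply: measurable_funB; [exact: Lfun_measurable lw'|exact: Lfun_measurable lv]].
congr (_ + _%:E <= _)%E; apply: eq_Rintegral => x _.
by rewrite !translateE addrK.
Qed.

Lemma subdiffZ (m : R) v xi : 1 < p -> 0 < m -> subdiff s p v xi ->
  subdiff s p (fun x => m * v x) (fun x => m `^ (p - 1) * xi x).
Proof.
move=> p1 m0 [lv lxi H]; have p0 : 0 < p by exact: lt_trans p1.
split; [exact: Lfun2Z..|move=> w lw].
have lw' := Lfun2Z m^-1 lw; have mw' := Lfun_measurable lw'.
have -> : J w = J (fun x => m * (m^-1 * w x)).
  by congr gagliardo; apply/funext => x; rewrite mulVKf ?gt_eqF.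
have mv := Lfun_measurable lv.
rewrite (gagliardoZ p0 (ltW m0) mv) (gagliardoZ p0 (ltW m0) mw').
have -> : \int[mu]_x (m `^ (p - 1) * xi x * (w x - m * v x)) =
    m `^ p * \int[mu]_x (xi x * (m^-1 * w x - v x)).
  rewrite -RintegralZl//; last by apply: integrable_mul2 => //; exact: Lfun2B.
  apply: eq_Rintegral => x _; rewrite -(mulr_powRB1 (ltW m0) p0).
  by field; rewrite gt_eqF.
rewrite EFinM; have := H _ lw'; have := gagliardo_ge0 s p1 (fun x => m^-1 * w x).
have mp : 0 < m `^ p by rewrite powR_gt0.
set I := Rintegral _ _ _.
have := gagliardo_ge0 s p1 v.
case: (J v) => [a| |]// _; first case: (J _) => [b| |]// _.
- by rewrite -!EFinM -!EFinD !lee_fin -mulrDr ler_pM2l.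
- by move=> _; rewrite [leRHS]gt0_muley ?lte_fin// leey.
- by case: (J _) => [c| |]// _ _; rewrite [leRHS]gt0_muley ?lte_fin// leey.
Qed.

End energy_scaling.

(** * Resolvents, density of finite energy, and the barrier *)

Section resolvents.
Context {R : realType} {N : nat}.
Variables s p : R.
Hypothesis p1 : 1 < p.
Local Notation E := 'rV[R]_N.
Local Notation mu := (lebesgue_rV R N).
Local Notation L2 := (Lfun mu 2%:E).
Local Notation J := (@gagliardo R N s p).
Implicit Types (f g u v w xi chi : E -> R) (h : R).

Lemma gagliardo_min1 u : measurable_fun setT u ->
  (J (fun x => Num.min (u x) 1)%R <= J u)%E.
Proof.
move=> mu_; have p0 : 0 < p by exact: lt_trans p1.
rewrite !gagliardoE lee_wpmul2l ?lee_fin ?invr_ge0 ?mulr_ge0 ?(ltW p0)//.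
apply: ge0_le_integral => //.
- by move=> z _; rewrite lee_fin energy_density_ge0.
- apply/measurable_EFinP; apply: measurable_energy_density.
  exact: measurable_minr.
- by apply/measurable_EFinP; exact: measurable_energy_density.
move=> z _; rewrite lee_fin /energy_density ler_wpM2r ?invr_ge0 ?powR_ge0//.
rewrite ge0_ler_powR ?nnegrE ?(ltW p0)//.
case: (leP (u z.1) 1) => u1; case: (leP (u z.2) 1) => u2 //.
- rewrite distrC ger0_norm ?subr_ge0// distrC ger0_norm; lra.
- rewrite ger0_norm ?subr_ge0// ger0_norm; lra.
- by rewrite subrr normr0.
Qed.

(** The test function is [v] truncated at height [1], which has less energy. *)
Lemma resolvent_le1 h f v : 0 < h -> resolvent s p h f v ->
  {ae mu, forall x, f x <= 1} -> {ae mu, forall x, v x <= 1}.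
Proof.
move=> h0 rv f1; have [lv lxi H] := rv; have mv := Lfun_measurable lv.
have lw : (fun x => Num.min (v x) 1) \in L2.
  apply: Lfun2_le (lv) => [|x]; first exact: measurable_minr.
  by case: (leP (v x) 1) => // v1; rewrite !gtr0_norm// ?ltW//; lra.
have lz : (fun x => v x - Num.min (v x) 1) \in L2 by exact: Lfun2B.
have := H _ lw; have Jm := gagliardo_min1 mv; move/le_trans/(_ Jm).
have Jf := subdiff_fin p1 rv; have J0 := gagliardo_ge0 s p1 v.
rewrite -{2}[J v]adde0 leeD2lE; last by rewrite ge0_fin_numE.
rewrite lee_fin => I0.
suff : \int[mu]_x ((v x - Num.min (v x) 1) ^+ 2) <= 0.
  move=> /(sqr_Rintegral_le0 lz); apply: filterS => x.
  by case: (leP (v x) 1) => // v1 /eqP; rewrite gt_eqF// subr_gt0.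
rewrite -(pmulr_rle0 _ (eqbRL (invr_gt0 h) h0)) -RintegralZl//; last first.
  exact: integrable_sqr2.
apply: le_trans I0; apply: ae_le_Rintegral.
- exact: (integrableZl measurableT h^-1 (integrable_sqr2 lz)).
- by apply: integrable_mul2 => //; exact: Lfun2B.
apply: filterS f1 => x f1; case: (leP (v x) 1) => v1.
  by rewrite subrr expr0n/= !mulr0.
rewrite mulrAC mulrC ler_wpM2r ?invr_ge0 ?(ltW h0)//; nra.
Qed.

Lemma poweR2_le (x : \bar R) : (0 <= x)%E -> (x <= 1)%E -> (x `^ 2 <= x)%E.
Proof.
case: x => [r| |]; [rewrite !lee_fin => r0 r1|by rewrite leye_eq|by []].
by rewrite powR_mulrn// expr2 ler_piMl.
Qed.

Lemma cvge0_le (I : Type) (F : set_system I) (FF : Filter F) (x : I -> \bar R) (e : R) :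
  x i @[i --> F] --> 0%E -> 0 < e -> \forall i \near F, (x i <= e%:E)%E.
Proof.
move=> /fine_cvgP[xfin /cvgr_le xle] e0; near=> i.
rewrite -(@fineK _ (x i)); last by near: i.
by rewrite lee_fin; near: i; exact: xle.
Unshelve. all: by end_near. Qed.

Lemma dist_Lq2_cvg (I : Type) (F : set_system I) (FF : Filter F) (u_ : I -> E -> R) u :
  (\forall i \near F, measurable_fun setT (u_ i)) -> measurable_fun setT u ->
  dist_Lq 2 (u_ i) u @[i --> F] --> 0%E ->
  (\int[mu]_x ((u_ i x - u x) ^+ 2)%:E)%E @[i --> F] --> 0%E.
Proof.
move=> mun mu_ d0; apply: (squeeze_cvge _ (cvg_cst 0%E) d0).
have d1 := cvge0_le FF d0 ltr01; near=> i.
rewrite integral_ge0/=; last by move=> x _; rewrite lee_fin sqr_ge0.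
rewrite dist_Lq2_sqr//; last by near: i.
by apply: poweR2_le; [exact: Lnorm_ge0|near: i; exact: d1].
Unshelve. all: by end_near. Qed.

Definition unit_cube : set E := [set x | forall i, `[0, 1]%classic (x ord0 i)].

Lemma measurable_rV_box (A : 'I_N -> set R) : (forall i, measurable (A i)) ->
  measurable [set x : E | forall i, A i (x ord0 i)].
Proof.
move=> mA.
have -> : [set x : E | forall i, A i (x ord0 i)] =
    \bigcap_(i in [set: 'I_N]) (fun x : E => x ord0 i) @^-1` A i.
  by apply/seteqP; split => [x Ax i _|x Ax i]; [exact: Ax|exact: (Ax i)].
apply: fin_bigcap_measurable => // i _.
by rewrite -[X in measurable X]setTI; exact: measurable_rV_coord.
Qed.

Lemma measurable_unit_cube : measurable unit_cube.
Proof. by apply: (@measurable_rV_box (fun=> `[0, 1]%classic)). Qed.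

Lemma lebesgue_unit_cube : mu unit_cube = 1%E.
Proof.
rewrite [LHS](@lebesgue_rV_box R N (fun=> `[0, 1]%classic))// big1// => i _.
by rewrite lebesgue_measure_itv/= lte_fin ltr01 oppr0 adde0.
Qed.

Lemma Lfun2_unit_cube : (\1_unit_cube : E -> R) \in L2.
Proof.
have Uoo : (mu unit_cube < +oo)%E by rewrite lebesgue_unit_cube ltry.
exact: (Lfun2_indic measurable_unit_cube Uoo).
Qed.

Variable S : R -> (E -> R) -> E -> R.
Hypothesis semigroupS : fractional_p_semigroup s p S.

(** The semigroup supplies the resolvents: existence is read off the
    construction of its values by the exponential formula. *)
Lemma resolvent_exists h f : 0 < h -> f \in L2 -> exists v, resolvent s p h f v.
Proof.
move=> h0 lf; have [_ [V [V0 VS _]]] := semigroupS.2 h f h0 lf.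
by exists (V 1%N 1%N); have := VS 1%N 0%N isT; rewrite V0 divr1.
Qed.

(** The functions of finite energy are dense in [L^2], because the semigroup
    is continuous at time zero and its approximants have finite energy. *)
Lemma finite_energy_dense f (e : R) : f \in L2 -> 0 < e -> exists w,
  [/\ w \in L2, (J w < +oo)%E & (\int[mu]_x ((w x - f x) ^+ 2)%:E <= e%:E)%E].
Proof.
move=> lf e0; have [[H _] G] := (semigroupS.1 _ (ler1n R 2), semigroupS.2).
have mf := Lfun_measurable lf.
have e40 : 0 < e / 4 by rewrite divr_gt0.
have mS t : 0 < t -> measurable_fun setT (S t f).
  by move=> t0; apply: Lfun_measurable (semigroup_Lq H (ltW t0) lf).
have S0 : (\int[mu]_x ((S t f x - f x) ^+ 2)%:E)%E @[t --> 0^'+] --> 0%E.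
  apply: dist_Lq2_cvg => //; last exact: semigroup_continuous H _ lf.
  by near=> t; apply: mS; near: t; exact: nbhs_right_gt.
have [t [t0 St]] : exists t, 0 < t /\
    (\int[mu]_x ((S t f x - f x) ^+ 2)%:E <= (e / 4)%:E)%E.
  near (0 : R)^'+ => t; exists t; split; near: t; first exact: nbhs_right_gt.
  exact: (cvge0_le _ S0 e40).
have [lS [V [V0 VS VS0]]] := G t f t0 lf.
have lV n : (0 < n)%N -> V n n \in L2.
  by case: n => // n _; have [] := VS n.+1 n (ltnSn _).
have mV : \forall n \near \oo, measurable_fun setT (V n n).
  by exists 1%N => // n /= n0; exact: Lfun_measurable (lV n n0).
have V0' := dist_Lq2_cvg eventually_filter mV (mS t t0) VS0.
have [n [n0 Vn]] : exists n, (0 < n)%N /\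
    (\int[mu]_x ((V n n x - S t f x) ^+ 2)%:E <= (e / 4)%:E)%E.
  near \oo => n; exists n; split; near: n; first by exists 1%N.
  exact: (cvge0_le _ V0' e40).
exists (V n n); split; first exact: lV.
  by case: n n0 {Vn} => // n _; have := subdiff_fin p1 (VS n.+1 n (ltnSn _)); exact.
apply: (le_trans (sqr_integral_triangle _ (Lfun_measurable (lV n n0)) (mS t t0) mf)).
apply: (@le_trans _ _ (2%:E * ((e / 4)%:E + (e / 4)%:E))%E).
  by rewrite lee_wpmul2l// leeD.
by rewrite -EFinD -EFinM lee_fin; lra.
Unshelve. all: by end_near. Qed.

(** The barrier is the resolvent, with a small step [1 / k], of the indicator
    of the unit cube [U]: then [k (1_U - eta)] is a subgradient at [eta].  It
    equals [- k eta] outside [U], so a multiple of [eta] remains a subsolution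
    there while it grows at a rate of order [k].  For large [k] it is close to
    [1_U] in [L^2], hence at least [1/2] on a part of [U]. *)
Lemma barrier_exists (K : R) : exists k eta,
  [/\ K <= k /\ 0 < k,
      subdiff s p eta (fun x => k * (\1_unit_cube x - eta x)),
      {ae mu, forall x, 0 <= eta x},
      {ae mu, forall x, eta x <= 1} &
      (0 < mu (unit_cube `&` [set x | (2^-1 <= eta x)%R]))%E].
Proof.
have lU := Lfun2_unit_cube.
have [w [lw Jw wU]] := @finite_energy_dense _ 32^-1 lU ltac:(lra).
have [h [h0 hK hJ]] : exists h, [/\ 0 < h, K <= h^-1 &
    ((2 * h)%:E * J w <= 32^-1%:E)%E].
  have J0 := gagliardo_ge0 s p1 w.
  have [j Jj] : exists j, J w = j%:E by exists (fine (J w)); rewrite fineK// ge0_fin_numE.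
  rewrite Jj lee_fin in J0 *.
  (* the step makes both [2 h j <= 1/32] and [1 / h >= K] hold *)
  exists (64 * j + `|K| + 1)^-1; have D0 : 0 < 64 * j + `|K| + 1.
    by have := normr_ge0 K; lra.
  split; [by rewrite invr_gt0|by rewrite invrK; have := ler_norm K; lra|].
  rewrite -EFinM lee_fin mulrAC ler_pdivrMr//.
  by have := normr_ge0 K; lra.
have [eta reta] := resolvent_exists h0 lU.
have leta : eta \in L2 by have [] := reta.
exists h^-1, eta; split.
- by rewrite invr_gt0.
- rewrite (_ : (fun _ => _) = (fun x => (\1_unit_cube x - eta x) / h))//.
  by apply/funext => x; rewrite mulrC.
- by apply: (resolvent_ge0 p1 h0 reta); apply: aeW => x; rewrite indicE.
- by apply: (resolvent_le1 h0 reta); apply: aeW => x; rewrite indicE lern1 leq_b1.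
have meta := Lfun_measurable leta; have mU := Lfun_measurable lU.
have mA : measurable (unit_cube `&` [set x | 2^-1 <= eta x]).
  apply: measurableI; first exact: measurable_unit_cube.
  rewrite -[X in measurable X]setTI; apply: measurable_fun_ler => //.
rewrite lt0e measure_ge0 andbT; apply/eqP => A0.
have HB : mu (unit_cube `\` (unit_cube `&` [set x | 2^-1 <= eta x])) = 1%E.
  rewrite measureD//=; last 2 first.
  - exact: measurable_unit_cube.
  - by rewrite lebesgue_unit_cube ltry.
  rewrite setIA setIid; move: A0; rewrite /= => ->.
  by rewrite sube0; exact: lebesgue_unit_cube.
(* otherwise [eta] would be at distance at least 1/2 from 1 on almost all of
   the cube, whose measure is 1 *)
have : (4^-1%:E <= \int[mu]_x ((eta x - \1_unit_cube x) ^+ 2)%:E)%E.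
  rewrite -[leLHS]mule1 -HB; apply: sqr_chebyshev => //.
  - exact: measurable_funB.
  - by apply: measurableD => //; exact: measurable_unit_cube.
  - move=> x [Ux /= nUx]; have -> : \1_unit_cube x = 1 :> R by rewrite indicE mem_set.
    have e2 : eta x < 2^-1 by rewrite ltNge; apply/negP => ?; exact: nUx.
    have : 0 < (2^-1 - eta x) * (3 / 2 - eta x) by apply: mulr_gt0; lra.
    lra.
apply/negP; rewrite -ltNge.
have mw := Lfun_measurable lw.
apply: (le_lt_trans (sqr_integral_triangle _ meta mw mU)).
have := resolvent_persistence p1 h0 lU lw reta.
move=> H1; have H2 : (\int[mu]_x ((eta x - w x) ^+ 2)%:E <= 16^-1%:E)%E.
  apply: (le_trans H1); have -> : 16^-1 = 32^-1 + 32^-1 :> R by lra.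
  rewrite EFinD leeD//; apply: le_trans wU.
  under eq_integral do rewrite -sqrrN opprB.
  by [].
apply: (@le_lt_trans _ _ (2%:E * (16^-1%:E + 32^-1%:E))%E).
  by rewrite lee_wpmul2l// leeD.
by rewrite -EFinD -EFinM lte_fin; lra.
Qed.

End resolvents.

(** * One implicit step above the barrier *)

Section barrier.
Context {R : realType} {N : nat}.
Variables s p : R.
Hypothesis p1 : 1 < p.
Local Notation E := 'rV[R]_N.
Local Notation mu := (lebesgue_rV R N).
Local Notation L2 := (Lfun mu 2%:E).
Local Notation J := (@gagliardo R N s p).
Implicit Types (f g u v w xi chi c eta : E -> R) (Q : set E) (h k m : R).

(** [v] is so large far from [Q] that truncating it at height [m] inside [Q]
    gains energy at a rate at least [B]; [c] is a density of this gain. *)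
Definition far_field v Q (m B : R) := exists c,
  [/\ measurable_fun setT c, forall y, 0 <= c y,
    forall x y, Q x -> c y != 0 -> exists theta, [/\ theta <= v y,
      2 * m <= theta, 2 * m `^ (p - 1) <= (theta / 2) `^ (p - 1) &
      c y <= p / 2 * (theta / 2) `^ (p - 1) / enorm (x - y) `^ (N%:R + s * p)] &
    (B%:E <= ((2 * p)^-1)%:E * \int[mu]_y (c y)%:E)%E].

Lemma far_field_le v Q (m m' B B' : R) : 0 <= m' -> m' <= m -> B' <= B ->
  far_field v Q m B -> far_field v Q m' B'.
Proof.
move=> m'0 mm BB [c [mc c0 cQ cB]]; exists c; split => //; last first.
  by apply: le_trans cB; rewrite lee_fin.
move=> x y Qx /(cQ x y Qx)[th [thv th1 th2 th3]]; exists th; split => //.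
  by apply: le_trans th1; rewrite ler_pM2l.
apply: le_trans th2; rewrite ler_pM2l// ge0_ler_powR ?nnegrE ?subr_ge0 ?(ltW p1)//.
exact: le_trans mm.
Qed.

Lemma energy_density_gain v eta (m theta cy : R) (z : E * E) : 0 < m ->
  0 <= v z.1 -> v z.1 < m * eta z.1 -> eta z.1 <= 1 -> eta z.2 <= 1 ->
  theta <= v z.2 -> 2 * m <= theta -> 2 * m `^ (p - 1) <= (theta / 2) `^ (p - 1) ->
  cy <= p / 2 * (theta / 2) `^ (p - 1) / enorm (z.1 - z.2) `^ (N%:R + s * p) ->
  energy_density s p (fun x => Num.max (v x) (m * eta x)) z +
  energy_density s p (fun x => Num.min (v x) (m * eta x)) z +
  (m * eta z.1 - v z.1) * cy <=
  energy_density s p v z + energy_density s p (fun x => m * eta x) z.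
Proof.
move=> m0 v0 vm e1 e2 tv mt mt' cyle.
have b1 : m * eta z.1 <= m by rewrite ler_piMr ?(ltW m0).
have b2 : m * eta z.2 <= m by rewrite ler_piMr ?(ltW m0).
have bv : m * eta z.2 <= v z.2 by lra.
have := normr_powR_submodular_gain p1 v0 (ltW vm) b1 b2 tv mt mt'.
rewrite /energy_density (max_r (ltW vm)) (min_l (ltW vm)) (max_l bv) (min_r bv).
set D := enorm _ `^ _ in cyle *.
set X := `|_| `^ p; set Y := `|_| `^ p; set A := `|_| `^ p; set B := `|_| `^ p.
set g := p / 2 * _ => H.
have D0 : 0 <= D^-1 by rewrite invr_ge0 powR_ge0.
have H1 : (m * eta z.1 - v z.1) * cy <= g * (m * eta z.1 - v z.1) / D.
  by rewrite [leRHS]mulrAC [leRHS]mulrC ler_wpM2l// subr_ge0 ltW.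
have := ler_wpM2r D0 H; rewrite !mulrDl; lra.
Qed.

Lemma product_integral (g c : E -> R) : measurable_fun setT g -> measurable_fun setT c ->
  (forall x, 0 <= g x) -> (forall x, 0 <= c x) ->
  (\int[mu \x mu]_z (g z.1 * c z.2)%:E =
   (\int[mu]_x (g x)%:E) * (\int[mu]_x (c x)%:E))%E.
Proof.
move=> mg mc g0 c0.
have mgE : measurable_fun setT (EFin \o g) by exact/measurable_EFinP.
have mcE : measurable_fun setT (EFin \o c) by exact/measurable_EFinP.
have mgc : measurable_fun setT (fun z : E * E => (g z.1 * c z.2)%:E).
  apply/measurable_EFinP; apply: measurable_funM.
    by apply: (measurableT_comp mg); exact: measurable_fst.
  by apply: (measurableT_comp mc); exact: measurable_snd.
have H0 (z : E * E) : (0 <= (g z.1 * c z.2)%:E)%E by rewrite lee_fin mulr_ge0.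
have -> := @fubini_tonelli1 _ _ _ _ _ mu mu _ mgc H0.
transitivity (\int[mu]_x ((g x)%:E * \int[mu]_y (c y)%:E))%E.
  apply: eq_integral => x _; rewrite /fubini_F/=.
  have gx : (0 <= (g x)%:E)%E by rewrite lee_fin.
  have c0' y : setT y -> (0 <= (EFin \o c) y)%E by rewrite lee_fin.
  exact: (ge0_integralZl _ measurableT mcE c0' gx).
have := @ge0_integralZr _ _ _ mu _ measurableT _ mgE (\int[mu]_y (c y)%:E)%E.
apply; first by move=> x _; rewrite lee_fin.
by apply: integral_ge0 => y _; rewrite lee_fin.
Qed.

(** One implicit step: if the datum lies above [m' eta], the far field lets the
    solution rise above [m eta].  Outside [Q] the increase is paid by the
    negative subgradient [- k eta]; inside [Q] it is paid by the far field. *)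
Lemma barrier_step h f v Q k eta m m' : 0 < h -> 0 < k -> 0 < m ->
  measurable Q -> (mu Q < +oo)%E ->
  resolvent s p h f v ->
  subdiff s p eta (fun x => k * (\1_Q x - eta x)) ->
  {ae mu, forall x, 0 <= eta x} -> {ae mu, forall x, eta x <= 1} ->
  {ae mu, forall x, 0 <= v x} ->
  {ae mu, forall x, m' * eta x <= f x} ->
  (m - m') / h <= k * m `^ (p - 1) ->
  far_field v Q m (k * m `^ (p - 1)) ->
  {ae mu, forall x, m * eta x <= v x}.
Proof.
move=> h0 k0 m0 mQ Qoo rv seta eta0 eta1 v0 fm mm' [c [mc c0 cQ cB]].
have [lv lxi _] := rv; have [leta lk _] := seta.
have mv := Lfun_measurable lv; have meta := Lfun_measurable leta.
have sm := subdiffZ p1 m0 seta; have [lme lchi _] := sm.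
set B := k * m `^ (p - 1) in mm' cB.
have B0 : 0 < B by rewrite mulr_gt0// powR_gt0.
(* restricting to the points where the almost everywhere bounds hold makes the
   pairwise inequality hold everywhere on the product space *)
pose X := Q `&` [set x | 0 <= v x] `&` [set x | eta x <= 1].
have mX : measurable X.
  apply: measurableI; first apply: measurableI => //;
    by rewrite -[X in measurable X]setTI; apply: measurable_fun_ler.
have Xoo : (mu X < +oo)%E.
  by apply: le_lt_trans Qoo; apply: le_measure; rewrite ?inE//; move=> x [[]].
have lX : (\1_X : E -> R) \in L2 by exact: Lfun2_indic.
pose z x := Num.max (m * eta x - v x) 0.
have z0 x : 0 <= z x by rewrite /z le_max lexx orbT.
have lz : z \in L2 by apply: Lfun2_max; [exact: Lfun2B|exact: Lfun2_0].
have mz := Lfun_measurable lz.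
pose D1 := [set y | eta y <= 1].
have mD1 : measurable D1.
  by rewrite -[X in measurable X]setTI; apply: measurable_fun_ler.
pose g x := \1_X x * z x.
have mg : measurable_fun setT g by apply: measurable_funM => //; exact: measurable_indic.
have g0 x : 0 <= g x by rewrite mulr_ge0// indicE.
pose c' y := \1_D1 y * c y.
have mc' : measurable_fun setT c' by apply: measurable_funM => //; exact: measurable_indic.
have c'0 y : 0 <= c' y by rewrite mulr_ge0// indicE.
have ig : mu.-integrable setT (EFin \o g) by exact: integrable_mul2.
have c'E : (\int[mu]_y (c' y)%:E = \int[mu]_y (c y)%:E)%E.
  apply: ae_eq_integral => //; [exact/measurable_EFinP..|].
  by apply: filterS eta1 => y e1 _; rewrite /c' indicE mem_set// mul1r.
have mG : measurable_fun setT (fun z : E * E => g z.1 * c' z.2).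
  apply: measurable_funM.
    by apply: (measurableT_comp mg); exact: measurable_fst.
  by apply: (measurableT_comp mc'); exact: measurable_snd.
have := @subdiff_comparison _ _ _ _ p1 _ _ _ _ _ rv sm mG (fun z => mulr_ge0 (g0 _) (c'0 _)).
have HG (x : E * E) : energy_density s p (fun y => Num.max (v y) (m * eta y)) x +
    energy_density s p (fun y => Num.min (v y) (m * eta y)) x + g x.1 * c' x.2 <=
    energy_density s p v x + energy_density s p (fun y => m * eta y) x.
  have [|zx] := leP (m * eta x.1) (v x.1).
    rewrite -subr_le0 => zx; rewrite /g /z (max_r zx) mulr0 mul0r addr0.
    exact: energy_density_submodular.
  have [Xx|Xx] := pselect (X x.1); last first.
    rewrite /g indicE memNset// !mul0r addr0.
    exact: energy_density_submodular.
  have [->|cx] := eqVneq (c' x.2) 0.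
    by rewrite mulr0 addr0; exact: energy_density_submodular.
  have [Dx|Dx] := pselect (D1 x.2); last first.
    by move: cx; rewrite /c' indicE memNset// mul0r eqxx.
  move: cx; rewrite /c' /g !indicE !mem_set// !mul1r => cx.
  have [[Qx vx] ex] := Xx; have [th [th1 th2 th3 th4]] := cQ x.1 x.2 Qx cx.
  rewrite /z max_l ?subr_ge0 ?(ltW zx)//.
  exact: (energy_density_gain m0 vx zx ex Dx th1 th2 th3 th4).
move=> /(_ HG); rewrite product_integral// c'E.
have Ig0 : (0 <= \int[mu]_x (g x)%:E)%E by apply: integral_ge0 => x _; rewrite lee_fin.
move=> Hc.
have {Hc} : ((\int[mu]_x (((f x - v x) / h - m `^ (p - 1) * (k * (\1_Q x - eta x))) * z x))%:E
    + B%:E * \int[mu]_x (g x)%:E <= 0)%E.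
  apply: le_trans Hc; rewrite leeD2l// muleCA muleC.
  by rewrite lee_wpmul2l.
rewrite -EFin_Rintegral// -EFinM -EFinD lee_fin -RintegralZl// -RintegralD//; last 2 first.
- by apply: integrable_mul2 => //; exact: Lfun2B.
- exact: (integrableZl measurableT B ig).
move=> I0.
suff : \int[mu]_x (z x ^+ 2) <= 0.
  move=> /(sqr_Rintegral_le0 lz); apply: filterS => x; rewrite /z.
  by case: (leP (m * eta x - v x) 0) => [|fv /eqP]; [rewrite subr_le0|rewrite gt_eqF].
rewrite -(pmulr_rle0 _ (eqbRL (invr_gt0 h) h0)) -RintegralZl//; last first.
  exact: integrable_sqr2.
apply: le_trans I0; apply: ae_le_Rintegral.
- exact: (integrableZl measurableT h^-1 (integrable_sqr2 lz)).
- have i1 := integrable_mul2 (Lfun2B lxi lchi) lz.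
  exact: (integrableD measurableT i1 (integrableZl measurableT B ig)).
near=> x.
have v0x : 0 <= v x by near: x.
have e0x : 0 <= eta x by near: x.
have e1x : eta x <= 1 by near: x.
have fmx : m' * eta x <= f x by near: x.
have XQ : (x \in X) = (x \in Q).
  apply/idP/idP => /set_mem Hx; apply/mem_set; first by have [[]] := Hx.
  by split => //; split.
rewrite /g; have -> : \1_X x = \1_Q x :> R by rewrite !indicE XQ.
rewrite /z; case: (leP (m * eta x - v x) 0) => zx.
  by rewrite expr0n/= !mulr0 addr0.
(* on [Q] the far field absorbs [B * \1_Q]; elsewhere the term [B * eta] coming
   from the subgradient pays for the growth from [m'] to [m] *)
have H1 : (m - m') / h * eta x <= B * eta x by rewrite ler_wpM2r.
have H2 : ((m' - m) * eta x + (m * eta x - v x)) / h <= (f x - v x) / h.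
  by rewrite ler_wpM2r ?invr_ge0 ?(ltW h0)//; lra.
have -> : h^-1 * (m * eta x - v x) ^+ 2 = ((m * eta x - v x) / h) * (m * eta x - v x).
  by ring.
rewrite [B * _]mulrA -mulrDl ler_wpM2r ?(ltW zx)//.
move: H2; rewrite mulrDl (mulrAC _ (eta x)) => H2.
have -> : m `^ (p - 1) * (k * (\1_Q x - eta x)) = B * \1_Q x - B * eta x.
  by rewrite /B; ring.
move: H1 H2; rewrite !mulrBl; lra.
Unshelve. all: by end_near. Qed.

End barrier.

(** * Iterates of the resolvent *)

Section iterates.
Context {R : realType} {N : nat}.
Variables s p : R.
Hypothesis p12 : 1 < p < 2.
Local Notation E := 'rV[R]_N.
Local Notation mu := (lebesgue_rV R N).
Local Notation L2 := (Lfun mu 2%:E).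
Local Notation J := (@gagliardo R N s p).
Implicit Types (f g u v w xi chi eta : E -> R) (Q : set E) (c : E) (r h t : R).

Let p1 : 1 < p. Proof. by case/andP: p12. Qed.
Let p2 : p < 2. Proof. by case/andP: p12. Qed.

Definition iterates (h : R) (n : nat) f (V : nat -> E -> R) :=
  V 0%N = f /\ forall k, (k < n)%N -> resolvent s p h (V k) (V k.+1).

Lemma iterates_Lfun2 h n f V k : f \in L2 -> iterates h n f V -> (k <= n)%N ->
  V k \in L2.
Proof.
move=> lf [V0 VS]; case: k => [|k kn]; first by rewrite V0.
by have [] := VS k kn.
Qed.

Lemma iterates_le h n f g V W k : 0 < h -> iterates h n f V -> iterates h n g W ->
  {ae mu, forall x, f x <= g x} -> (k <= n)%N -> {ae mu, forall x, V k x <= W k x}.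
Proof.
move=> h0 [V0 VS] [W0 WS] fg; elim: k => [_|k IH kn]; first by rewrite V0 W0.
have := resolvent_le p1 h0 (VS k kn) (WS k kn) (IH (ltnW kn)); exact.
Qed.

Lemma iterates_ge0 h n f V k : 0 < h -> iterates h n f V ->
  {ae mu, forall x, 0 <= f x} -> (k <= n)%N -> {ae mu, forall x, 0 <= V k x}.
Proof.
move=> h0 [V0 VS] f0; elim: k => [_|k IH kn]; first by rewrite V0.
have := resolvent_ge0 p1 h0 (VS k kn) (IH (ltnW kn)); exact.
Qed.

Lemma iterates_persistence h n f V w k : 0 < h -> f \in L2 -> w \in L2 ->
  iterates h n f V -> (k <= n)%N ->
  (\int[mu]_x ((V k x - w x) ^+ 2)%:E <=
   \int[mu]_x ((f x - w x) ^+ 2)%:E + (2 * (k%:R * h))%:E * J w)%E.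
Proof.
move=> h0 lf lw HV; have [V0 VS] := HV.
elim: k => [_|k IH kn]; first by rewrite V0 mul0r mulr0 mul0e adde0.
have lV := iterates_Lfun2 lf HV (ltnW kn).
apply: (le_trans (resolvent_persistence p1 h0 lV lw (VS k kn))).
have kh : 0 <= k%:R * h by rewrite mulr_ge0// ltW.
apply: (@le_trans _ _ (\int[mu]_x ((f x - w x) ^+ 2)%:E +
    (2 * (k%:R * h))%:E * J w + (2 * h)%:E * J w)%E).
  by rewrite leeD2r// IH// ltnW.
rewrite -addeA leeD2l// -ge0_muleDl ?lee_fin ?mulr_ge0// ?(ltW h0)//.
have -> : 2 * (k.+1%:R * h) = 2 * (k%:R * h) + 2 * h by rewrite -[k.+1%:R]natr1; ring.
by rewrite -EFinD.
Qed.

(** The height [m_k] of the barrier after [k] steps solves [m' = a m^(p-1)]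
    up to the convexity error of the time discretization, which has the right
    sign; its explicit form also lets it start from zero. *)
Lemma barrier_speed (a h : R) (k : nat) : 0 < a -> 0 < h ->
  ((a * (2 - p) * (k.+1%:R * h)) `^ (2 - p)^-1 -
   (a * (2 - p) * (k%:R * h)) `^ (2 - p)^-1) / h <=
  a * ((a * (2 - p) * (k.+1%:R * h)) `^ (2 - p)^-1) `^ (p - 1).
Proof.
move=> a0 h0; set q := (2 - p)^-1.
have q0 : 0 < 2 - p by rewrite subr_gt0.
have q1 : 1 < q by rewrite /q invf_gt1//; have := p1; lra.
set x := _ * (k.+1%:R * h); set y := _ * (k%:R * h).
have x0 : 0 <= x by rewrite !mulr_ge0 ?(ltW q0) ?(ltW a0) ?(ltW h0).
have y0 : 0 <= y by rewrite !mulr_ge0 ?(ltW q0) ?(ltW a0) ?(ltW h0).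
have xy : y - x = - (a * (2 - p) * h).
  by rewrite /x /y -[k.+1%:R]natr1; ring.
have := powR_tangent q1 x0 y0; rewrite xy.
rewrite -powRrM; have -> : q * (p - 1) = q - 1 by rewrite /q; field; rewrite gt_eqF.
rewrite ler_pdivrMr//.
have -> : q * x `^ (q - 1) * - (a * (2 - p) * h) = - (a * x `^ (q - 1) * h).
  by rewrite /q; field; rewrite gt_eqF.
lra.
Qed.

Lemma iterates_barrier h n f V Q (a : R) eta : 0 < h -> 0 < a -> (0 < n)%N ->
  measurable Q -> (mu Q < +oo)%E -> iterates h n f V ->
  {ae mu, forall x, 0 <= f x} ->
  subdiff s p eta (fun x => a * (\1_Q x - eta x)) ->
  {ae mu, forall x, 0 <= eta x} -> {ae mu, forall x, eta x <= 1} ->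
  let m := (a * (2 - p) * (n%:R * h)) `^ (2 - p)^-1 in
  (forall k, (k < n)%N -> far_field s p (V k.+1) Q m (a * m `^ (p - 1))) ->
  {ae mu, forall x, m * eta x <= V n x}.
Proof.
move=> h0 a0 n0 mQ Qoo HV f0 seta eta0 eta1 m Hfar.
have q0 : 0 < 2 - p by rewrite subr_gt0.
have qi0 : 0 < (2 - p)^-1 by rewrite invr_gt0.
pose mk k := (a * (2 - p) * (k%:R * h)) `^ (2 - p)^-1.
have mkn k : (k <= n)%N -> mk k <= m.
  move=> kn; apply: ge0_ler_powR; rewrite ?nnegrE ?(ltW qi0)//.
  - by rewrite !mulr_ge0 ?(ltW q0) ?(ltW a0) ?(ltW h0).
  - by rewrite !mulr_ge0 ?(ltW q0) ?(ltW a0) ?(ltW h0).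
  by rewrite ler_wpM2l ?mulr_ge0 ?(ltW q0) ?(ltW a0)// ler_wpM2r ?(ltW h0)// ler_nat.
suff H : forall k, (k <= n)%N -> {ae mu, forall x, mk k * eta x <= V k x} by exact: H.
move: (m) mkn Hfar => {}m mkn Hfar.
have mk0 k : 0 <= mk k by exact: powR_ge0.
have p10 : 0 <= p - 1 by rewrite subr_ge0 ltW.
have mspeed k : (mk k.+1 - mk k) / h <= a * mk k.+1 `^ (p - 1) by exact: barrier_speed.
have mk_gt0 k : 0 < mk k.+1 by rewrite powR_gt0// !mulr_gt0.
have mk00 : mk 0%N = 0 by rewrite /mk mul0r mulr0 powR0 ?gt_eqF.
clearbody mk.
have [V0 VS] := HV.
elim=> [_|k IH kn].
  rewrite V0 mk00; apply: filterS f0 => x; by rewrite mul0r.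
have Vk0 := iterates_ge0 h0 HV f0 kn.
have Mk : mk k.+1 `^ (p - 1) <= m `^ (p - 1).
  apply: ge0_ler_powR; rewrite ?nnegrE//; last exact: mkn.
  by rewrite (le_trans (mk0 k.+1))// mkn.
have far := far_field_le p1 (mk0 k.+1) (mkn k.+1 kn) (ler_wpM2l (ltW a0) Mk) (Hfar k kn).
exact: (barrier_step p1 h0 a0 (mk_gt0 k) mQ Qoo (VS k kn) seta eta0 eta1 Vk0
  (IH (ltnW kn)) (mspeed k) far).
Qed.

Variable S : R -> (E -> R) -> E -> R.
Hypothesis semigroupS : fractional_p_semigroup s p S.

(** The step is fixed to [t / n], so that the iterates of several data can be
    compared before the limit is taken. *)
Lemma semigroup_iterates t f : 0 < t -> f \in L2 ->
  S t f \in L2 /\ exists V : nat -> nat -> E -> R,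
    (forall n, (0 < n)%N -> iterates (t / n%:R) n f (V n)) /\
    (\int[mu]_x ((V n n x - S t f x) ^+ 2)%:E)%E @[n --> \oo] --> 0%E.
Proof.
move=> t0 lf; have [lS [V [V0 VS VS0]]] := semigroupS.2 t f t0 lf.
split=> //; exists V; split; first by move=> n n0; split; [exact: V0|exact: VS].
apply: (dist_Lq2_cvg eventually_filter) VS0 => //; last exact: Lfun_measurable lS.
exists 1%N => // n /= n0.
by apply: Lfun_measurable (iterates_Lfun2 (h := t / n%:R) lf _ (leqnn n)); split; [exact: V0|exact: VS].
Qed.

Lemma semigroup_ge t f g : 0 < t -> f \in L2 -> measurable_fun setT g ->
  (forall n V, (0 < n)%N -> iterates (t / n%:R) n f V ->
    {ae mu, forall x, g x <= V n x}) ->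
  {ae mu, forall x, g x <= S t f x}.
Proof.
move=> t0 lf mg H; have [lS [V [HV VS0]]] := semigroup_iterates t0 lf.
have lV n : (0 < n)%N -> V n n \in L2.
  by move=> n0; exact: iterates_Lfun2 lf (HV n n0) (leqnn n).
pose V' n := V n.+1 n.+1.
apply: (@ae_le_sqr_lim _ _ _ mu g (S t f) V' mg (Lfun_measurable lS)).
- by move=> n; exact: (Lfun_measurable (lV n.+1 (ltn0Sn n))).
- by apply: nearW => n; exact: (H n.+1 (V n.+1) (ltn0Sn n) (HV n.+1 (ltn0Sn n))).
- by move: VS0; rewrite -(cvg_shiftS (fun n => \int[mu]_x ((V n n x - S t f x) ^+ 2)%:E)%E).
Qed.

Lemma semigroup_ge0 t f : 0 < t -> f \in L2 -> {ae mu, forall x, 0 <= f x} ->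
  {ae mu, forall x, 0 <= S t f x}.
Proof.
move=> t0 lf f0; apply: (@semigroup_ge t f (fun=> 0)) => // n V n0 HV.
by apply: iterates_ge0 HV f0 (leqnn n); rewrite divr_gt0// ltr0n.
Qed.

Definition cube (c : E) (r : R) : set E :=
  affine_rV r^-1 (- (r^-1 *: c)) @^-1` @unit_cube R N.

Lemma measurable_cube c r : measurable (cube c r).
Proof.
rewrite -[X in measurable X]setTI; apply: measurable_affine_rV => //.
exact: measurable_unit_cube.
Qed.

Lemma lebesgue_cube c r : 0 < r -> mu (cube c r) = (r ^+ N)%:E.
Proof.
move=> r0; rewrite /cube lebesgue_rV_affine ?invr_gt0//; last exact: measurable_unit_cube.
by rewrite exprVn invrK lebesgue_unit_cube mule1.
Qed.

(** On a large cube carrying a large datum the iterates remain large for a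
    while on a fixed proportion of the cube: compare with the iterates of a
    constant multiple of the indicator, which stay close to a scaled copy of
    the function [w] of finite energy. *)
Lemma cube_persistence w (j : R) (kap r T : R) c f V n h k :
  w \in L2 -> J w = j%:E ->
  (\int[mu]_x ((w x - \1_(@unit_cube R N) x) ^+ 2)%:E <= 64^-1%:E)%E ->
  0 < kap -> 0 < r -> 0 < T -> T = n%:R * h -> (0 < n)%N ->
  2 * T * (kap `^ p * (r^-1 `^ (N%:R + s * p) * (r^-1 ^- N * r^-1 ^- N)) * j) <=
    kap ^+ 2 * r ^+ N / 64 ->
  f \in L2 -> {ae mu, forall x, 0 <= f x} ->
  (mu (cube c r `&` [set x | (f x < kap)%R]) <= (r ^+ N / 64)%:E)%E ->
  iterates h n f V -> (k <= n)%N ->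
  ((r ^+ N / 4)%:E <= mu (cube c r `&` [set x | (kap / 2 <= V k x)%R]))%E.
Proof.
move=> lw Jw wU kap0 r0 T0 TE n0 HT lf f0 fkap HV kn.
have nR0 : 0 < n%:R :> R by rewrite ltr0n.
have h0 : 0 < h by rewrite -(pmulr_rgt0 _ nR0) -TE.
have ri0 : 0 < r^-1 by rewrite invr_gt0.
have rN0 : 0 < r ^+ N by rewrite exprn_gt0.
have mf := Lfun_measurable lf; have mw := Lfun_measurable lw.
have mC := measurable_cube c r; have muC := lebesgue_cube c r0.
have Coo : (mu (cube c r) < +oo)%E by rewrite muC ltry.
pose A := cube c r `&` [set x | kap <= f x].
have mA : measurable A.
  apply: measurableI => //.
  by rewrite -[X in measurable X]setTI; apply: measurable_fun_ler.
have Aoo : (mu A < +oo)%E.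
  by apply: le_lt_trans Coo; apply: le_measure; rewrite ?inE//; exact: subIsetl.
have lA : (\1_A : E -> R) \in L2 by exact: Lfun2_indic.
have lC : (\1_(cube c r) : E -> R) \in L2 by exact: Lfun2_indic.
pose f1 x := kap * \1_A x; have lf1 : f1 \in L2 by exact: Lfun2Z.
pose kC x := kap * \1_(cube c r) x; have lkC : kC \in L2 by exact: Lfun2Z.
pose w1 x := kap * (w \o affine_rV r^-1 (- (r^-1 *: c))) x.
have lwa := Lfun2_affine (- (r^-1 *: c)) ri0 lw.
have lw1 : w1 \in L2 by exact: Lfun2Z.
have hE : h = T / n%:R by rewrite TE mulrAC divff ?gt_eqF// mul1r.
have [_ [V' [/(_ n n0) + _]]] := semigroup_iterates T0 lf1.
rewrite -hE; set W := V' n => HW.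
have WV : {ae mu, forall x, W k x <= V k x}.
  apply: iterates_le h0 HW HV _ kn; apply: filterS f0 => x f0x.
  rewrite /f1 indicE; have [Ax|Ax] := pselect (A x).
    by rewrite mem_set// mulr1; have [] := Ax.
  by rewrite memNset// mulr0.
have lW := iterates_Lfun2 lf1 HW kn.
have mW := Lfun_measurable lW; have mf1 := Lfun_measurable lf1.
have mkC := Lfun_measurable lkC; have mw1 := Lfun_measurable lw1.
have mV := Lfun_measurable (iterates_Lfun2 lf HV kn).
set Z := kap ^+ 2 * r ^+ N in HT *.
have Z0 : 0 < Z by rewrite mulr_gt0// exprn_gt0.
(* with [Z] the square norm of [kap * \1_cube], the datum [f1] and the scaled
   function [w1] are each within [Z / 64] of it, the evolution costs at most
   [Z / 64], and two triangle inequalities give [12 / 64 * Z] *)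
have I1 : (\int[mu]_x ((f1 x - kC x) ^+ 2)%:E <= (Z / 64)%:E)%E.
  rewrite (eq_integral (fun x => (kap ^+ 2)%:E * (\1_(cube c r `\` A) x)%:E)%E); last first.
    move=> x _; rewrite -EFinM /f1 /kC -mulrBr exprMn; congr (_ * _)%:E.
    rewrite !indicE; have [Cx|Cx] := pselect (cube c r x).
      have [Ax|Ax] := pselect (A x).
        by rewrite (mem_set Cx) (mem_set Ax) memNset ?subrr ?expr0n//; case.
      by rewrite (mem_set Cx) (memNset Ax) mem_set// sub0r sqrrN expr1n.
    have Ax : ~ A x by case.
    by rewrite (memNset Cx) (memNset Ax) memNset ?subrr ?expr0n//; case.
  rewrite ge0_integralZl//; last first.
  - by rewrite lee_fin sqr_ge0.
  - apply/measurable_EFinP; apply: measurable_indic; exact: measurableD.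
  rewrite integral_indic ?setIT//; last exact: measurableD.
  rewrite /Z -mulrA [leRHS]EFinM lee_wpmul2l ?lee_fin ?sqr_ge0//.
  have -> : cube c r `\` A = cube c r `&` [set x | f x < kap]; last by [].
  apply/seteqP; split => x [Cx].
    by move=> nA; split => //=; rewrite ltNge; apply/negP => ?; exact: nA.
  by move=> /= fx; split => // -[_ /=]; rewrite leNgt fx.
have I2 : (\int[mu]_x ((w1 x - kC x) ^+ 2)%:E <= (Z / 64)%:E)%E.
  have md : measurable_fun setT (fun x => kap * (w x - \1_(@unit_cube R N) x)).
    apply: measurable_funM => //; apply: measurable_funB => //.
    exact: measurable_indic measurable_unit_cube.
  have -> : (\int[mu]_x ((w1 x - kC x) ^+ 2)%:E =
      (r^-1 ^- N)%:E * \int[mu]_x ((kap * (w x - \1_(@unit_cube R N) x)) ^+ 2)%:E)%E.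
    by rewrite -(sqr_integral_affine (- (r^-1 *: c)) ri0 md);
      apply: eq_integral => x _; rewrite mulrBr.
  under eq_integral do rewrite exprMn EFinM.
  rewrite ge0_integralZl//; last 3 first.
  - apply: measurable_EFin_sqr; apply: measurable_funB => //.
    exact: measurable_indic measurable_unit_cube.
  - by move=> x _; rewrite lee_fin sqr_ge0.
  - by rewrite lee_fin sqr_ge0.
  rewrite exprVn invrK.
  apply: (@le_trans _ _ ((r ^+ N)%:E * ((kap ^+ 2)%:E * 64^-1%:E))%E).
    by rewrite !lee_wpmul2l ?lee_fin ?sqr_ge0 ?(ltW rN0).
  by rewrite -!EFinM lee_fin /Z; lra.
have I3 : (\int[mu]_x ((W k x - w1 x) ^+ 2)%:E <= (5 / 64 * Z)%:E)%E.
  apply: (le_trans (iterates_persistence h0 lf1 lw1 HW kn)).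
  have -> : 5 / 64 * Z = 4 / 64 * Z + Z / 64 by lra.
  rewrite EFinD; apply: leeD.
    apply: (le_trans (sqr_integral_triangle _ mf1 mkC mw1)).
    apply: (@le_trans _ _ (2%:E * ((Z / 64)%:E + (Z / 64)%:E))%E).
      rewrite lee_wpmul2l// leeD//.
      apply: le_trans I2; under eq_integral do rewrite -sqrrN opprB.
      by [].
    by rewrite -EFinD -EFinM lee_fin; lra.
  rewrite /w1 gagliardoZ ?(lt_trans _ p1)// ?(ltW kap0)//; last exact: Lfun_measurable lwa.
  rewrite gagliardo_affine// Jw -!EFinM lee_fin; apply: le_trans HT.
  have j0 : 0 <= j by rewrite -lee_fin -Jw; exact: gagliardo_ge0.
  have kT : k%:R * h <= T by rewrite TE ler_wpM2r ?(ltW h0)// ler_nat.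
  rewrite [kap `^ p * (_ * j)]mulrA ler_wpM2r ?ler_pM2l//.
  by rewrite !mulr_ge0 ?powR_ge0 ?invr_ge0 ?exprn_ge0 ?(ltW r0) ?invr_ge0 ?(ltW r0).
have I4 : (\int[mu]_x ((W k x - kC x) ^+ 2)%:E <= (12 / 64 * Z)%:E)%E.
  apply: (le_trans (sqr_integral_triangle _ mW mw1 mkC)).
  apply: (@le_trans _ _ (2%:E * ((5 / 64 * Z)%:E + (Z / 64)%:E))%E).
    by rewrite lee_wpmul2l// leeD.
  by rewrite -EFinD -EFinM lee_fin; lra.
pose B := cube c r `&` [set x | W k x < kap / 2].
have mB : measurable B.
  apply: measurableI => //.
  by rewrite -[X in measurable X]setTI; apply: measurable_fun_ltr.
have muB : (mu B <= (3 / 4 * r ^+ N)%:E)%E.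
  have HB : ((kap ^+ 2 / 4)%:E * mu B <= \int[mu]_x ((W k x - kC x) ^+ 2)%:E)%E.
    apply: sqr_chebyshev => //; first exact: measurable_funB.
    - move=> x [Cx /= Wx]; rewrite /kC indicE mem_set// mulr1.
      have -> : kap ^+ 2 / 4 = (kap / 2) ^+ 2 by field.
      by rewrite -[leRHS]sqrrN opprB ler_sqr ?nnegrE; lra.
    - by rewrite mulr_ge0 ?sqr_ge0.
  have k20 : 0 < kap ^+ 2 / 4 by rewrite divr_gt0// exprn_gt0.
  rewrite -(@lee_pmul2l _ (kap ^+ 2 / 4)%:E)//.
  apply: (le_trans HB); apply: (le_trans I4).
  by rewrite -EFinM lee_fin /Z; lra.
have [M [mM M0 MV]] := WV.
pose G := cube c r `&` [set x | kap / 2 <= V k x].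
have mG : measurable G.
  apply: measurableI => //.
  by rewrite -[X in measurable X]setTI; apply: measurable_fun_ler.
have CG : cube c r `<=` G `|` (B `|` M).
  move=> x Cx; have [Vx|Vx] := leP (kap / 2) (V k x); first by left.
  right; have [WVx|WVx] := leP (W k x) (V k x).
    by left; split => //=; exact: le_lt_trans Vx.
  by right; apply: MV => /=; rewrite leNgt WVx.
have : ((r ^+ N)%:E <= mu G + (mu B + mu M))%E.
  rewrite -muC; apply: (@le_trans _ _ (mu (G `|` (B `|` M)))).
    by apply: le_measure; rewrite ?inE//; do 2 apply: measurableU => //.
  have U1 := measureU2 (lebesgue_rV R N) mG (measurableU _ _ mB mM).
  have U2 := measureU2 (lebesgue_rV R N) mB mM.
  by apply: (le_trans U1); rewrite leeD2l.
rewrite M0 adde0 => H.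
have Goo : (mu G < +oo)%E.
  by apply: le_lt_trans Coo; apply: le_measure; rewrite ?inE//; exact: subIsetl.
have : ((r ^+ N)%:E <= mu G + (3 / 4 * r ^+ N)%:E)%E by apply: (le_trans H); rewrite leeD2l.
have : (mu G \is a fin_num) by rewrite ge0_fin_numE.
rewrite -/G; case: (mu G) => [g| |]// _; rewrite !lee_fin; lra.
Qed.

End iterates.

(** * The far field carried by large shells *)

Section lower_bound.
Context {R : realType} {N : nat}.
Variables s p : R.
Hypothesis N_gt0 : (0 < N)%N.
Hypothesis s_gt0 : 0 < s.
Hypothesis p12 : 1 < p < 2.
Local Notation E := 'rV[R]_N.
Local Notation mu := (lebesgue_rV R N).
Local Notation L2 := (Lfun mu 2%:E).
Local Notation J := (@gagliardo R N s p).
Local Notation gamma1 := (s * p / (p - 1)).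
Implicit Types (f g u v w eta : E -> R) (Q : set E) (x y : E) (r : R).

Let p1 : 1 < p. Proof. by case/andP: p12. Qed.
Let p2 : p < 2. Proof. by case/andP: p12. Qed.
Let p0 : 0 < p. Proof. exact: lt_trans p1. Qed.
Let sp0 : 0 < s * p. Proof. exact: mulr_gt0. Qed.
Let pB0 : 0 < p - 1. Proof. by rewrite subr_gt0. Qed.
Let q0 : 0 < 2 - p. Proof. by rewrite subr_gt0. Qed.

Lemma gamma1_gt0 : 0 < gamma1. Proof. exact: divr_gt0. Qed.

Lemma enorm_ge x (i : 'I_N) : `|x ord0 i| <= enorm x.
Proof.
rewrite /enorm -sqrtr_sqr ler_wsqrtr// (bigD1 i)//= lerDl.
by apply: sumr_ge0 => j _; exact: sqr_ge0.
Qed.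

Lemma enorm_le x (d : R) : 0 <= d -> (forall i, `|x ord0 i| <= d) ->
  enorm x <= Num.sqrt N%:R * d.
Proof.
move=> d0 xd; have -> : Num.sqrt N%:R * d = Num.sqrt (N%:R * d ^+ 2).
  by rewrite sqrtrM ?ler0n// sqrtr_sqr ger0_norm.
rewrite ler_wsqrtr//.
apply: (@le_trans _ _ (\sum_(i < N) d ^+ 2)).
  apply: ler_sum => i _; rewrite -[leLHS]real_normK ?num_real//.
  by rewrite ler_sqr ?nnegrE.
by rewrite sumr_const card_ord mulr_natl.
Qed.

(** A cube of side [r] at distance about [r] from [x0], placed on the side of
    [x0] that leads away from the origin, so that the growing data are at
    least as large there as they are at distance [r] from the origin. *)
Definition shell (x0 : E) r : set E :=
  cube (\row_i (if 0 <= x0 ord0 i then x0 ord0 i + r else x0 ord0 i - 2 * r)) r.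

Lemma shellP (x0 : E) r y (i : 'I_N) : 0 < r -> shell x0 r y ->
  r <= `|y ord0 i - x0 ord0 i| <= 2 * r /\ r <= `|y ord0 i|.
Proof.
move=> r0 /(_ i); rewrite /affine_rV/= !mxE in_itv/=.
rewrite -mulrBr => /andP[].
rewrite (pmulr_rge0 _ (eqbRL (invr_gt0 r) r0)) subr_ge0.
rewrite [X in X <= 1]mulrC ler_pdivrMr// mul1r.
case: ifPn => [x00 H1 H2|].
  rewrite !ger0_norm; [by split; [apply/andP; split|]; lra|lra|lra].
rewrite -ltNge => x00 H1 H2.
rewrite !ler0_norm; [by split; [apply/andP; split|]; lra|lra|lra].
Qed.

Lemma measurable_shell (x0 : E) r : measurable (shell x0 r).
Proof. exact: measurable_cube. Qed.

Lemma lebesgue_shell (x0 : E) r : 0 < r -> mu (shell x0 r) = (r ^+ N)%:E.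
Proof. exact: lebesgue_cube. Qed.

(** What a shell on which the solution is comparable to [C |x|^gamma1]
    contributes to the far field.  It does not depend on the size of the shell,
    which is what makes [gamma1] critical: many shells give an arbitrarily
    large total. *)
Definition shell_gain (C : R) : R :=
  (C / 4) `^ (p - 1) / 16 / (Num.sqrt N%:R * 3) `^ (N%:R + s * p).

Lemma shell_gain_gt0 C : 0 < C -> 0 < shell_gain C.
Proof.
by move=> C0; rewrite !divr_gt0 ?powR_gt0 ?mulr_gt0 ?sqrtr_gt0 ?ltr0n ?divr_gt0.
Qed.

Lemma powR_natD r : 0 < r -> r `^ (N%:R + s * p) = r ^+ N * r `^ (s * p).
Proof.
move=> r0; rewrite powRD; first by rewrite powR_mulrn// ltW.
by rewrite (gt_eqF r0) implybT.
Qed.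

Lemma shell_gainE C r : 0 < C -> 0 < r ->
  (2 * p)^-1 * (p / 2 * (C * r `^ gamma1 / 4) `^ (p - 1) /
    (Num.sqrt N%:R * (3 * r)) `^ (N%:R + s * p) * (r ^+ N / 4)) = shell_gain C.
Proof.
move=> C0 r0; have r0' := ltW r0.
have -> : (C * r `^ gamma1 / 4) `^ (p - 1) = (C / 4) `^ (p - 1) * r `^ (s * p).
  have -> : C * r `^ gamma1 / 4 = C / 4 * r `^ gamma1 by ring.
  by rewrite powRM ?powR_ge0 ?divr_ge0 ?(ltW C0)// -powRrM divfK// gt_eqF.
have -> : (Num.sqrt N%:R * (3 * r)) `^ (N%:R + s * p) =
    (Num.sqrt N%:R * 3) `^ (N%:R + s * p) * (r ^+ N * r `^ (s * p)).
  have N3 : 0 <= Num.sqrt N%:R * 3 :> R by rewrite mulr_ge0// sqrtr_ge0.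
  by rewrite [_ * (3 * r)]mulrA (powRM _ N3 r0') (powR_natD r0).
rewrite /shell_gain.
have D0 : (Num.sqrt N%:R * 3) `^ (N%:R + s * p) != 0.
  by rewrite gt_eqF// powR_gt0// mulr_gt0// sqrtr_gt0 ltr0n.
have r1 : r `^ (s * p) != 0 by rewrite gt_eqF// powR_gt0.
have r2 : r ^+ N != 0 by rewrite gt_eqF// exprn_gt0.
have p00 : p != 0 by rewrite gt_eqF.
by field; rewrite ?r1 ?r2 ?D0 ?p00.
Qed.

Lemma far_field_of_shells v Q (x0 : E) (l m B C : R) (n : nat) (rho : nat -> R) :
  0 < C -> 0 <= l -> measurable_fun setT v ->
  (forall x, Q x -> forall i, `|x ord0 i - x0 ord0 i| <= l) ->
  (forall j, l < rho j) ->
  (forall i j, (i < j)%N -> 2 * rho i < rho j) ->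
  (forall j, 4 * m <= C * rho j `^ gamma1) ->
  (forall j, 2 * m `^ (p - 1) <= (C * rho j `^ gamma1 / 4) `^ (p - 1)) ->
  (forall j, (j < n)%N -> ((rho j ^+ N / 4)%:E <=
    mu (shell x0 (rho j) `&` [set x | (C * rho j `^ gamma1 / 2 <= v x)%R]))%E) ->
  B <= n%:R * shell_gain C ->
  far_field s p v Q m B.
Proof.
move=> C0 l0 mv Ql lrho rho2 m4 m2 muD Bn.
have rho0 j : 0 < rho j by exact: le_lt_trans (lrho j).
pose D j := shell x0 (rho j) `&` [set x | C * rho j `^ gamma1 / 2 <= v x].
have mD j : measurable (D j).
  apply: measurableI; first exact: measurable_shell.
  by rewrite -[X in measurable X]setTI; apply: measurable_fun_ler.
pose cc j := p / 2 * (C * rho j `^ gamma1 / 4) `^ (p - 1) /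
  (Num.sqrt N%:R * (3 * rho j)) `^ (N%:R + s * p).
have cc0 j : 0 <= cc j by rewrite !mulr_ge0 ?powR_ge0 ?invr_ge0 ?powR_ge0 ?(ltW p0).
have disj i j y : D i y -> D j y -> i = j.
  pose i0 := Ordinal N_gt0.
  move=> [Di _] [Dj _].
  have [/andP[a1 a2] _] := shellP i0 (rho0 i) Di.
  have [/andP[b1 b2] _] := shellP i0 (rho0 j) Dj.
  by case: (ltngtP i j) => [/rho2 ij|/rho2 ij|//]; exfalso; lra.
(* the shells are disjoint, so at most one term of the sum is nonzero *)
pose c y := \sum_(j < n) cc j * \1_(D j) y.
have mc : measurable_fun setT c.
  by apply: measurable_sum => j; apply: measurable_funM.
have cE (j : 'I_n) y : D j y -> c y = cc j.
  move=> Dy; rewrite /c (bigD1 j)//= big1 ?addr0; last first.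
    move=> i ij; rewrite indicE memNset ?mulr0// => Di.
    by move/eqP: ij; apply; apply/val_inj; exact: disj Di Dy.
  by rewrite indicE mem_set// mulr1.
exists c; split => //.
- by move=> y; apply: sumr_ge0 => j _; rewrite mulr_ge0// indicE.
- move=> x y Qx cy0.
  have [j Dj] : exists j : 'I_n, D j y.
    apply: contrapT => nD; move/eqP: cy0; apply; rewrite /c big1// => j _.
    by rewrite indicE memNset ?mulr0// => Dj; apply: nD; exists j.
  exists (C * rho j `^ gamma1 / 2); split.
  + by have [] := Dj.
  + by have := m4 j; lra.
  + by have -> : C * rho j `^ gamma1 / 2 / 2 = C * rho j `^ gamma1 / 4 by field.
  rewrite (cE j y Dj) /cc.
  have -> : C * rho j `^ gamma1 / 2 / 2 = C * rho j `^ gamma1 / 4 by field.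
  rewrite ler_wpM2l ?mulr_ge0 ?powR_ge0 ?(ltW p0)//.
  have [Sy _] := Dj.
  have xy0 : 0 < enorm (x - y).
    apply: lt_le_trans (enorm_ge _ (Ordinal N_gt0)).
    rewrite !mxE normr_gt0 subr_eq0; apply/eqP => xy.
    have [/andP[+ _] _] := shellP (Ordinal N_gt0) (rho0 j) Sy.
    by have := Ql x Qx (Ordinal N_gt0); have := lrho j; rewrite xy; lra.
  have xyle : enorm (x - y) <= Num.sqrt N%:R * (3 * rho j).
    apply: enorm_le => [|i]; first by rewrite mulr_ge0// ltW.
    rewrite !mxE; have [/andP[_ H] _] := shellP i (rho0 j) Sy.
    have -> : x ord0 i - y ord0 i = (x ord0 i - x0 ord0 i) - (y ord0 i - x0 ord0 i).
      by ring.
    apply: (le_trans (ler_normB _ _)).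
    by have := Ql x Qx i; have := lrho j; lra.
  rewrite lef_pV2 ?posrE ?powR_gt0// ?(lt_le_trans xy0)//.
  by rewrite ge0_ler_powR ?nnegrE ?addr_ge0 ?ler0n ?(ltW sp0) ?(ltW xy0) ?(le_trans (ltW xy0)).
rewrite /c; under eq_integral do rewrite -sumEFin.
rewrite ge0_integral_sum//; last 2 first.
- by move=> j; apply/measurable_EFinP; apply: measurable_funM => //; exact: measurable_indic.
- by move=> j y _; rewrite lee_fin mulr_ge0// indicE.
have p20 : (0 <= ((2 * p)^-1)%:E :> \bar R)%E by rewrite lee_fin invr_ge0 mulr_ge0// ltW.
apply: (@le_trans _ _ (((2 * p)^-1)%:E * \sum_(j < n) (cc j * (rho j ^+ N / 4))%:E)%E).
  rewrite sumEFin -EFinM lee_fin mulr_sumr.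
  under eq_bigr do rewrite shell_gainE//.
  by rewrite sumr_const card_ord -mulr_natl.
rewrite lee_wpmul2l//; apply: lee_sum => j _.
under eq_integral do rewrite EFinM.
rewrite ge0_integralZl//; last 2 first.
- by apply/measurable_EFinP; exact: measurable_indic.
- by rewrite lee_fin.
by rewrite integral_indic// setIT EFinM lee_wpmul2l ?lee_fin// muD.
Qed.

Lemma powR_eventually (a A : R) : 0 < a -> exists r0, 1 <= r0 /\
  forall r, r0 <= r -> A <= r `^ a.
Proof.
move=> a0; exists ((`|A| + 1) `^ a^-1).
have A1 : 1 <= `|A| + 1 by rewrite lerDr.
split.
  have E1 : 1 = 1 `^ a^-1 :> R by rewrite powR1.
  by rewrite [leLHS]E1 ge0_ler_powR ?nnegrE ?invr_ge0 ?(ltW a0)//.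
move=> r rr; apply: (@le_trans _ _ (`|A| + 1)).
  by have := ler_norm A; lra.
have -> : `|A| + 1 = ((`|A| + 1) `^ a^-1) `^ a.
  by rewrite -powRrM mulVf ?gt_eqF// powRr1// (le_trans ler01 A1).
by rewrite ge0_ler_powR ?nnegrE ?(ltW a0) ?powR_ge0// (le_trans _ rr) ?powR_ge0.
Qed.

Lemma shell_scale (m A C l : R) : 0 < C -> exists r0, [/\ 1 <= r0, l < r0 &
  forall r, r0 <= r -> [/\ 4 * m <= C * r `^ gamma1,
    2 * m `^ (p - 1) <= (C * r `^ gamma1 / 4) `^ (p - 1) & A <= r `^ (s * p)]].
Proof.
move=> C0.
have [r1 [r11 H1]] := powR_eventually (4 * m / C) gamma1_gt0.
have [r2 [r21 H2]] := powR_eventually (2 * m `^ (p - 1) / (C / 4) `^ (p - 1)) sp0.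
have [r3 [r31 H3]] := powR_eventually A sp0.
have l0 := normr_ge0 l; have l1 := ler_norm l.
exists (r1 + r2 + r3 + `|l|); split; [lra|lra|move=> r rr]; split.
- by rewrite [leRHS]mulrC -ler_pdivrMr//; apply: H1; lra.
- have -> : (C * r `^ gamma1 / 4) `^ (p - 1) = (C / 4) `^ (p - 1) * r `^ (s * p).
    have -> : C * r `^ gamma1 / 4 = C / 4 * r `^ gamma1 by ring.
    by rewrite powRM ?powR_ge0 ?divr_ge0 ?(ltW C0)// -powRrM divfK// gt_eqF.
  by rewrite [leRHS]mulrC -ler_pdivrMr ?powR_gt0 ?divr_gt0//; apply: H2; lra.
- by apply: H3; lra.
Qed.

(** The time scale of a cube of side [r] and height [C r^gamma1] is at least of
    order [r^(s p)], so [T] is eventually short. *)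
Lemma persistence_scale (C T j r : R) : 0 < C -> 0 < T -> 1 <= r ->
  128 * T * j / C `^ (2 - p) <= r `^ (s * p) -> 0 <= j ->
  2 * T * ((C * r `^ gamma1) `^ p *
    (r^-1 `^ (N%:R + s * p) * (r^-1 ^- N * r^-1 ^- N)) * j) <=
    (C * r `^ gamma1) ^+ 2 * r ^+ N / 64.
Proof.
move=> C0 T0 r1 Hr j0; have r0 : 0 < r by lra.
set kap := C * _; have kap0 : 0 < kap by rewrite mulr_gt0// powR_gt0.
have X0 : 0 < r `^ (s * p) by rewrite powR_gt0.
have -> : r^-1 `^ (N%:R + s * p) * (r^-1 ^- N * r^-1 ^- N) = r ^+ N / r `^ (s * p).
  rewrite exprVn invrK -powR_inv1 ?(ltW r0)// -powRrM mulN1r powRN.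
  rewrite powR_natD//.
  by field; rewrite ?gt_eqF ?exprn_gt0.
have K2 : kap ^+ 2 = kap `^ p * kap `^ (2 - p).
  have := @powRD R kap p (2 - p); rewrite (gt_eqF kap0) implybT => /(_ isT) <-.
  have -> : p + (2 - p) = 2%:R by ring.
  by rewrite powR_mulrn// ltW.
have K3 : C `^ (2 - p) <= kap `^ (2 - p).
  rewrite ge0_ler_powR ?nnegrE ?(ltW q0) ?(ltW C0) ?(ltW kap0)//.
  have E1 : 1 = 1 `^ gamma1 :> R by rewrite powR1.
  rewrite /kap ler_peMr ?(ltW C0)// [leLHS]E1.
  by rewrite ge0_ler_powR ?nnegrE ?(ltW gamma1_gt0) ?(ltW r0).
have H : 128 * T * j <= kap `^ (2 - p) * r `^ (s * p).
  apply: (@le_trans _ _ (C `^ (2 - p) * r `^ (s * p))).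
    by rewrite [leRHS]mulrC -ler_pdivrMr ?powR_gt0.
  by rewrite ler_wpM2r ?powR_ge0.
have -> : 2 * T * (kap `^ p * (r ^+ N / r `^ (s * p)) * j) =
   (kap `^ p * r ^+ N / 64) * (128 * T * j / r `^ (s * p)).
  by field; rewrite gt_eqF.
have -> : kap ^+ 2 * r ^+ N / 64 = (kap `^ p * r ^+ N / 64) * kap `^ (2 - p).
  by rewrite K2; ring.
rewrite ler_wpM2l ?divr_ge0 ?mulr_ge0 ?powR_ge0 ?exprn_ge0 ?(ltW r0)//.
by rewrite ler_pdivrMr.
Qed.

End lower_bound.

(** * The uniform lower bound *)

Section uniform_lower_bound.
Context {R : realType} {N : nat}.
Variables s p : R.
Hypothesis N_gt0 : (0 < N)%N.
Hypothesis s_gt0 : 0 < s.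
Hypothesis p12 : 1 < p < 2.
Local Notation E := 'rV[R]_N.
Local Notation mu := (lebesgue_rV R N).
Local Notation L2 := (Lfun mu 2%:E).
Local Notation J := (@gagliardo R N s p).
Local Notation gamma1 := (s * p / (p - 1)).
Implicit Types (f g u v w eta : E -> R) (x y b : E) (r : R).
Variable S : R -> (E -> R) -> E -> R.
Hypothesis semigroupS : fractional_p_semigroup s p S.

Lemma ae_translate b (P : E -> Prop) :
  {ae mu, forall x, P x} -> {ae mu, forall x, P (x + b)}.
Proof.
move=> [M [mM M0 PM]]; exists (affine_rV 1 b @^-1` M); split.
- by rewrite -[X in measurable X]setTI; exact: measurable_affine_rV.
- by rewrite lebesgue_rV_affine// M0 mule0.
- by move=> x nP; apply: PM; move: nP; rewrite /= /affine_rV scale1r.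
Qed.

(** If [u] lies above every translate of [eta] by vectors of a large set, then
    it lies above the values that [eta] takes on a set of positive measure:
    average over the translations. *)
Lemma ae_ge_of_translates u eta (Z0 P : set E) (k e : R) :
  measurable_fun setT u -> measurable_fun setT eta ->
  measurable Z0 -> measurable P -> (0 < mu P)%E -> (forall x, P x -> e <= eta x) ->
  0 <= k ->
  (forall b, (exists x, Z0 x /\ P (x + b)) ->
    {ae mu, forall x, k * eta (x + b) <= u x}) ->
  {ae mu, forall x, Z0 x -> k * e <= u x}.
Proof.
move=> mu_ meta mZ0 mP P0 Pe k0 H.
pose Z := Z0 `&` [set x | u x < k * e].
have mZ : measurable Z.
  apply: measurableI => //.
  by rewrite -[X in measurable X]setTI; apply: measurable_fun_ltr.
pose F (z : E * E) := (\1_Z z.1 * \1_P (z.1 + z.2))%:E : \bar R.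
have mZ1 : measurable_fun setT (\1_Z : E -> R) by exact: measurable_indic.
have mP1 : measurable_fun setT (\1_P : E -> R) by exact: measurable_indic.
have madd : measurable_fun setT (fun z : E * E => z.1 + z.2).
  apply: measurable_fun_rVP => i; under eq_fun do rewrite mxE.
  by apply: measurable_funD; apply: (measurableT_comp (measurable_rV_coord i));
    [exact: measurable_fst|exact: measurable_snd].
have mF : measurable_fun setT F.
  apply/measurable_EFinP; apply: measurable_funM.
    by apply: (measurableT_comp mZ1); exact: measurable_fst.
  exact: (measurableT_comp mP1 madd).
have F0 z : (0 <= F z)%E by rewrite lee_fin mulr_ge0// indicE.
have mPE : measurable_fun setT (fun y => (\1_P y)%:E : \bar R).
  by apply/measurable_EFinP; exact: measurable_indic.
have mZE : measurable_fun setT (fun y => (\1_Z y)%:E : \bar R).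
  by apply/measurable_EFinP; exact: measurable_indic.
have := @fubini_tonelli _ _ _ _ _ mu mu F mF F0.
have -> : (\int[mu]_x \int[mu]_y F (x, y) = mu Z * mu P)%E.
  transitivity (\int[mu]_x ((\1_Z x)%:E * mu P))%E.
    apply: eq_integral => x _.
    have H1 : (\int[mu]_y (\1_P (x + y))%:E = mu P)%E.
      transitivity (\int[mu]_y (\1_P (affine_rV 1 x y))%:E)%E.
        by apply: eq_integral => y _; rewrite /affine_rV scale1r addrC.
      rewrite (@ge0_integral_affine _ N 1 x (fun y => (\1_P y)%:E))//.
      by rewrite expr1n invr1 mul1e integral_indic// setIT.
    rewrite -H1.
    have mPx : measurable_fun setT (fun y => (\1_P (x + y))%:E : \bar R).
      have mx : measurable_fun setT (fun y : E => x + y).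
        have -> : (fun y : E => x + y) = affine_rV 1 x.
          by apply/funext => y; rewrite /affine_rV scale1r addrC.
        exact: measurable_affine_rV.
      by apply/measurable_EFinP; exact: (measurableT_comp mP1 mx).
    apply: (@ge0_integralZl _ _ _ mu setT measurableT _ mPx (\1_Z x)%:E).
      by move=> y _; rewrite lee_fin indicE.
    by rewrite lee_fin indicE.
  have := @ge0_integralZr _ _ _ mu setT measurableT _ mZE (mu P).
  rewrite integral_indic// setIT; apply; last exact: measure_ge0.
  by move=> y _; rewrite lee_fin indicE.
have -> : (\int[mu]_y \int[mu]_x F (x, y) = 0)%E.
  apply: integral0_eq => b _.
  have [nb|Hb] := pselect (exists x, Z0 x /\ P (x + b)); last first.
    apply: integral0_eq => x _; rewrite /F/= !indicE.
    have [Zx|Zx] := pselect (Z x); last by rewrite (memNset Zx) mul0r.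
    have [Px|Px] := pselect (P (x + b)); last by rewrite (memNset Px) mulr0.
    by exfalso; apply: Hb; exists x; have [] := Zx.
  rewrite (ae_eq_integral (cst 0%E))//; last 2 first.
  - by apply: (measurableT_comp mF); exact: pair2_measurable.
  - apply: filterS (H b nb) => x ux _; rewrite /F/= !indicE.
    have [Zx|Zx] := pselect (Z x); last by rewrite (memNset Zx) mul0r.
    have [Px|Px] := pselect (P (x + b)); last by rewrite (memNset Px) mulr0.
    exfalso; have [_ /=] := Zx; rewrite ltNge => /negP; apply.
    by apply: le_trans ux; rewrite ler_wpM2l// Pe.
  by rewrite integral0.
move=> /eqP; rewrite mule_eq0 (gt_eqF P0) orbF => /eqP Z0'.
exists Z; split => //; move=> x /= /not_implyP[Zx].
by move=> /negP; rewrite -ltNge => ux; split.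
Qed.

Lemma unit_cubeP x (i : 'I_N) : unit_cube x -> `|x ord0 i| <= 1.
Proof.
by move=> /(_ i); rewrite /= in_itv/= => /andP[x0 x1]; rewrite ger0_norm.
Qed.

(** Finitely many shells, the same for all centers and times, decide whether
    the solution is large near the center.  On each of them the iterates stay
    large on a fixed proportion of the shell; together they feed the barrier,
    translated to all places near the center.  Only the measure of the bad part
    of each shell enters, which suits data that are merely limits almost
    everywhere. *)
Lemma uniform_lower_bound (C t1 t2 L M : R) : 0 < C -> 0 < t1 -> t1 <= t2 -> 0 < L ->
  exists (n : nat) (rho : nat -> R), (forall j, 1 <= rho j) /\
  forall (x0 : E) f, f \in L2 -> {ae mu, forall x, 0 <= f x} ->
  (forall j, (j < n)%N -> (mu (shell x0 (rho j) `&`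
      [set x | (f x < C * rho j `^ gamma1)%R]) <= (rho j ^+ N / 64)%:E)%E) ->
  forall t, t1 <= t -> t <= t2 ->
  {ae mu, forall x, enorm (x - x0) < L -> M <= S t f x}.
Proof.
move=> C0 t10 t12 L0; have /andP[p1 p2] := p12.
have q0 : 0 < 2 - p by rewrite subr_gt0.
have t20 : 0 < t2 by exact: lt_le_trans t12.
pose M1 := `|M| + 1; have M10 : 0 < M1 by rewrite ltr_wpDl.
have MM1 : M <= M1 by have := ler_norm M; rewrite /M1; lra.
have [a [eta [[Ka a0] seta eta0 eta1 P0]]] :=
  barrier_exists p1 semigroupS ((2 * M1) `^ (2 - p) / ((2 - p) * t1)).
(* [mt t] is the height of the barrier at time [t]: at least [2 * M1] from [t1]
   on by the choice of [a], at most [m] up to [t2] *)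
pose mt t := (a * (2 - p) * t) `^ (2 - p)^-1.
have mt_mono t t' : 0 <= t -> t <= t' -> mt t <= mt t'.
  move=> t0 tt'; apply: ge0_ler_powR; rewrite ?nnegrE ?invr_ge0 ?(ltW q0)//.
  - by rewrite !mulr_ge0 ?(ltW a0) ?(ltW q0).
  - by rewrite !mulr_ge0 ?(ltW a0) ?(ltW q0)// (le_trans t0).
  - by rewrite ler_wpM2l ?mulr_ge0 ?(ltW a0) ?(ltW q0).
have mt1 : 2 * M1 <= mt t1.
  have -> : 2 * M1 = ((2 * M1) `^ (2 - p)) `^ (2 - p)^-1.
    by rewrite -powRrM mulfV ?gt_eqF// powRr1// mulr_ge0// ltW.
  apply: ge0_ler_powR; rewrite ?nnegrE ?invr_ge0 ?(ltW q0) ?powR_ge0//.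
    by rewrite !mulr_ge0 ?(ltW a0) ?(ltW q0) ?(ltW t10).
  by rewrite -mulrA -ler_pdivrMr ?mulr_gt0.
have [m mE] : exists m, m = mt t2 by exists (mt t2).
have [w [lw Jw wU]] := @finite_energy_dense R N s p p1 S semigroupS _ 64^-1
  (@Lfun2_unit_cube R N) ltac:(lra).
have J0 := gagliardo_ge0 s p1 w.
have [j Jj] : exists j, J w = j%:E by exists (fine (J w)); rewrite fineK// ge0_fin_numE.
have j0 : 0 <= j by rewrite -lee_fin -Jj.
have [r0 [r01 Lr0 Hr0]] := shell_scale s_gt0 p12 m (128 * t2 * j / C `^ (2 - p)) (L + 3) C0.
have gain0 : 0 < @shell_gain R N s p C by exact: shell_gain_gt0.
pose n := (Num.truncn (a * m `^ (p - 1) / @shell_gain R N s p C)).+1.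
(* the ratio 3 exceeds 2, so that the shells are disjoint *)
pose rho i := r0 * 3 ^+ i.
have r00 : 0 < r0 by exact: lt_le_trans ltr01 r01.
have Lr2 : L + 2 < r0 by apply: lt_trans Lr0; rewrite ltrD2l ltr_nat.
have rho_ge i : r0 <= rho i.
  by rewrite /rho ler_peMr ?(ltW r00)// exprn_ege1// ler1n.
have rho1 i : 1 <= rho i by exact: le_trans (rho_ge i).
exists n, rho; split=> // x0 f lf f0 fbad t tt1 tt2.
have t0 : 0 < t by exact: lt_le_trans tt1.
have leta : eta \in L2 by have [] := seta.
have meta := Lfun_measurable leta.
pose P := @unit_cube R N `&` [set x | 2^-1 <= eta x].
have mP : measurable P.
  apply: measurableI; first exact: measurable_unit_cube.
  by rewrite -[X in measurable X]setTI; apply: measurable_fun_ler.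
pose Z0 := [set x : E | enorm (x - x0) < L].
have mZ0 : measurable Z0.
  rewrite -[X in measurable X]setTI; apply: measurable_fun_ltr => //.
  apply: (measurableT_comp measurable_enorm).
  have -> : (fun x : E => x - x0) = affine_rV 1 (- x0).
    by apply/funext => x; rewrite /affine_rV scale1r.
  exact: measurable_affine_rV.
have lS : S t f \in L2 by have [] := semigroup_iterates semigroupS t0 lf.
have M1mt : 2 * M1 <= mt t by apply: (le_trans mt1); apply: mt_mono => //; exact: ltW.
have mt0 : 0 < mt t by apply: lt_le_trans M1mt; rewrite mulr_gt0.
suff : {ae mu, forall x, Z0 x -> mt t * 2^-1 <= S t f x}.
  apply: filterS => x H Zx; apply: le_trans (H Zx); lra.
apply: (ae_ge_of_translates (Lfun_measurable lS) meta mZ0 mP P0) => //.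
- by move=> x [].
- exact: ltW.
move=> b [x1 [Zx1 [Ux1 _]]].
have bx0 i : `|b ord0 i + x0 ord0 i| <= L + 1.
  have H1 := le_lt_trans (enorm_ge (x1 - x0) i) Zx1.
  have H2 := unit_cubeP i Ux1; rewrite !mxE in H1 H2.
  have -> : b ord0 i + x0 ord0 i = (x1 ord0 i + b ord0 i) - (x1 ord0 i - x0 ord0 i).
    by ring.
  by apply: (le_trans (ler_normB _ _)); lra.
pose Q := affine_rV 1 b @^-1` @unit_cube R N.
have mQ : measurable Q.
  rewrite -[X in measurable X]setTI; apply: measurable_affine_rV => //.
  exact: measurable_unit_cube.
have Qoo : (mu Q < +oo)%E.
  rewrite /Q lebesgue_rV_affine//; last exact: measurable_unit_cube.
  by rewrite expr1n invr1 mul1e lebesgue_unit_cube ltry.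
have Ql x : Q x -> forall i, `|x ord0 i - x0 ord0 i| <= L + 2.
  move=> Qx i; have := unit_cubeP i Qx; rewrite /affine_rV scale1r mxE => H1.
  have -> : x ord0 i - x0 ord0 i = (x ord0 i + b ord0 i) - (b ord0 i + x0 ord0 i).
    by ring.
  by apply: (le_trans (ler_normB _ _)); have := bx0 i; lra.
have setab : subdiff s p (translate b eta) (fun x => a * (\1_Q x - translate b eta x)).
  exact: subdiff_translate seta.
have lb := Lfun2_translate b leta.
suff : {ae mu, forall x, mt t * translate b eta x <= S t f x}.
  by apply: filterS => x; rewrite translateE.
apply: (semigroup_ge semigroupS (g := fun x => mt t * translate b eta x) t0 lf).
  by apply: measurable_funM => //; exact: Lfun_measurable lb.
move=> k V k0 HV.
have kR0 : 0 < k%:R :> R by rewrite ltr0n.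
have h0 : 0 < t / k%:R by rewrite divr_gt0.
have tE : k%:R * (t / k%:R) = t by rewrite mulrC divfK// gt_eqF.
have etab0 : {ae mu, forall x, 0 <= translate b eta x}.
  by apply: filterS (ae_translate b eta0) => x; rewrite translateE.
have etab1 : {ae mu, forall x, translate b eta x <= 1}.
  by apply: filterS (ae_translate b eta1) => x; rewrite translateE.
have := iterates_barrier p12 h0 a0 k0 mQ Qoo HV f0 setab etab0 etab1.
rewrite tE -/(mt t); apply => i ik.
have mtm : mt t <= m by rewrite mE; apply: mt_mono => //; exact: ltW.
have lV := iterates_Lfun2 lf HV ik.
have Hn : a * m `^ (p - 1) <= n%:R * @shell_gain R N s p C.
  by rewrite -ler_pdivrMr//; apply: ltW; exact: truncnS_gt.
have Bm : a * mt t `^ (p - 1) <= a * m `^ (p - 1).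
  have m0 : 0 <= m by exact: le_trans (ltW mt0) mtm.
  by rewrite ler_pM2l//; apply: ge0_ler_powR; rewrite ?nnegrE ?subr_ge0 ?(ltW p1) ?(ltW mt0).
apply: (far_field_le p1 (ltW mt0) mtm Bm).
apply: (far_field_of_shells N_gt0 s_gt0 p12 C0 (l := L + 2) (x0 := x0) (n := n) (rho := rho)) => //.
- by rewrite addr_ge0// ltW.
- exact: Lfun_measurable lV.
- by move=> l; exact: lt_le_trans Lr2 (rho_ge l).
- move=> l l' ll'; rewrite /rho mulrCA ltr_pM2l//.
  apply: (@lt_le_trans _ _ (3 ^+ l.+1)).
    by rewrite exprS ltr_pM2r ?exprn_gt0// ltr_nat.
  by rewrite ler_eXn2l ?ltr1n.
- by move=> l; have [] := Hr0 _ (rho_ge l).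
- by move=> l; have [] := Hr0 _ (rho_ge l).
move=> l ln; have [_ _ Hl] := Hr0 _ (rho_ge l).
have rl0 : 0 < rho l by exact: lt_le_trans (rho1 l).
have kl0 : 0 < C * rho l `^ gamma1 by rewrite mulr_gt0// powR_gt0.
apply: (cube_persistence p12 semigroupS lw Jj wU kl0 rl0 t0 (esym tE) k0 _ lf f0 _ HV ik).
- apply: persistence_scale => //; apply: le_trans Hl.
  rewrite ler_wpM2r ?invr_ge0 ?powR_ge0// ler_wpM2r//.
  by rewrite ler_pM2l.
- exact: fbad.
Qed.

End uniform_lower_bound.

(** * Consequences of the lower bound for approximating data *)

Section large_values.
Context {R : realType}.
Import HBNNSimple.

(** The constant on [A] is one of the simple functions whose supremum defines
    the integral; this serves for integrals in time, whose integrand is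
    estimated at each time separately. *)
Lemma ge0_integral_ge_cst d (T : measurableType d) (nu : {measure set T -> \bar R})
    (D A : set T) (f : T -> \bar R) (k : R) : measurable A -> A `<=` D -> 0 <= k ->
  (forall x, D x -> (0 <= f x)%E) -> (forall x, A x -> (k%:E <= f x)%E) ->
  (k%:E * nu A <= \int[nu]_(x in D) f x)%E.
Proof.
move=> mA AD k0 f0 kf; rewrite ge0_integralE//.
pose h : {nnsfun T >-> R} := scale_nnsfun (indic_nnsfun R mA) k0.
have hE x : h x = k * \1_A x by [].
have <- : sintegral nu h = (k%:E * nu A)%E.
  rewrite -integralT_nnsfun; under eq_integral do rewrite hE EFinM.
  rewrite ge0_integralZl ?lee_fin//; last first.
    by apply/measurable_EFinP; exact: measurable_indic.
  by rewrite integral_indic// setIT.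
have hf x : ((h x)%:E <= (f \_ D) x)%E.
  rewrite hE indicE /patch; have [Ax|Ax] := pselect (A x).
    by rewrite mem_set// mulr1 mem_set; [exact: kf|exact: AD].
  by rewrite (memNset Ax) mulr0; case: ifPn => // /set_mem; exact: f0.
by apply: ereal_sup_ubound; exists h.
Qed.

Lemma ae_integral_ge_cst d (T : measurableType d) (nu : {measure set T -> \bar R})
    (D : set T) (f : T -> R) (k : R) : measurable D -> 0 <= k ->
  measurable_fun D f -> {ae nu, forall x, D x -> k <= f x} ->
  (k%:E * nu D <= \int[nu]_(x in D) (f x)%:E)%E.
Proof.
move=> mD k0 mf kf.
rewrite (@ae_eq_integral _ _ _ nu D (fun x => (Num.max (f x) k)%:E))//; last 3 first.
- exact/measurable_EFinP.
- by apply/measurable_EFinP; exact: measurable_maxr.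
- by apply: filterS kf => x kf Dx; rewrite max_l// kf.
apply: ge0_integral_ge_cst => // x _; rewrite lee_fin le_max ?lexx ?orbT//.
by rewrite k0 orbT.
Qed.

Lemma near_forall_ltn (P : nat -> nat -> Prop) (n : nat) :
  (forall j, \forall m \near \oo, P j m) ->
  \forall m \near \oo, forall j, (j < n)%N -> P j m.
Proof.
move=> H; elim: n => [|n IH]; first by apply: nearW.
near=> m => j; rewrite ltnS leq_eqVlt => /predU1P[->|jn].
  by near: m; exact: H.
by move: j jn; near: m.
Unshelve. all: by end_near. Qed.

Lemma measure_small_eventually d (T : measurableType d)
    (nu : {measure set T -> \bar R}) (B : set T) (A : nat -> set T) (e : R) :
  measurable B -> (nu B < +oo)%E -> (forall n, measurable (A n)) ->
  (forall n, A n `<=` B) -> {ae nu, forall x, \forall n \near \oo, ~ A n x} -> 0 < e ->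
  \forall n \near \oo, (nu (A n) <= e%:E)%E.
Proof.
move=> mB Boo mA AB An e0.
have mI (D : set T) : measurable D -> measurable_fun setT (fun x => (\1_D x)%:E : \bar R).
  by move=> mD; apply/measurable_EFinP; exact: measurable_indic.
have [|||_ _] := @dominated_convergence _ _ _ nu setT measurableT
  (fun n x => (\1_(A n) x)%:E) (cst 0%E) (fun x => (\1_B x)%:E)
  (fun n => mI _ (mA n)) (measurable_cst _).
- apply: filterS An => x An _; apply: (cvg_trans _ (cvg_cst 0%E)).
  by apply: near_eq_cvg; apply: filterS An => n An /=; rewrite indicE memNset.
- exact: eventually_filter.
- apply/integrableP; split; first exact: mI.
  rewrite (eq_integral (fun x => (\1_B x)%:E)); first by rewrite integral_indic// setIT.
  by move=> x _; rewrite gee0_abs// lee_fin indicE.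
- apply: aeW => x n _; rewrite lee_fin ger0_norm ?indicE//.
  have [Ax|Ax] := pselect (A n x); last by rewrite (memNset Ax).
  by rewrite !mem_set//; exact: AB Ax.
rewrite integral0 => H; apply: filterS (cvge0_le eventually_filter H e0) => n.
by rewrite integral_indic// setIT.
Unshelve. all: by end_near. Qed.

(** Integrable data are cut down to square-integrable ones, for which the
    iterates are available. *)
Lemma Lfun1_truncation d (T : measurableType d) (nu : {measure set T -> \bar R})
    (f : T -> R) (K : R) : 0 <= K -> f \in Lfun nu 1%E ->
  let g x := Num.min (Num.max (f x) 0) K in
  g \in Lfun nu 1%E /\ g \in Lfun nu 2%:E.
Proof.
move=> K0 lf g; have mf := Lfun_measurable lf.
have fi : nu.-integrable setT (EFin \o f) by exact/Lfun1_integrable.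
have mg : measurable_fun setT g.
  by apply: measurable_minr => //; exact: measurable_maxr.
have g0 x : 0 <= g x by rewrite /g le_min K0 andbT le_max lexx orbT.
have gf x : g x <= `|f x|.
  by rewrite /g ge_min; apply/orP; left; rewrite ge_max ler_norm normr_ge0.
have gK x : g x <= K by rewrite /g ge_min lexx orbT.
split.
  apply/Lfun1_integrable; apply: (le_integrable measurableT _ _ fi).
    exact/measurable_EFinP.
  by move=> x _; rewrite /= lee_fin ger0_norm.
apply/Lfun2P; split => //.
have Kf : nu.-integrable setT (fun x => K%:E * (EFin \o f) x)%E by exact: integrableZl.
have /integrableP[mKf] := Kf; apply: le_lt_trans; apply: ge0_le_integral => //.
- by move=> x _; rewrite lee_fin sqr_ge0.
- exact: measurable_EFin_sqr.
- exact: measurableT_comp.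
move=> x _; rewrite /= lee_fin normrM (ger0_norm K0) expr2.
by apply: ler_pM.
Qed.

End large_values.

Section divergence.
Context {R : realType} {N : nat}.
Variables s p : R.
Hypothesis N_gt0 : (0 < N)%N.
Hypothesis s_gt0 : 0 < s.
Hypothesis p12 : 1 < p < 2.
Local Notation E := 'rV[R]_N.
Local Notation mu := (lebesgue_rV R N).
Local Notation L2 := (Lfun mu 2%:E).
Local Notation gamma1 := (s * p / (p - 1)).
Implicit Types (f g u v : E -> R) (x y : E) (r t : R).
Variable S : R -> (E -> R) -> E -> R.
Hypothesis semigroupS : fractional_p_semigroup s p S.

Let p1 : 1 < p. Proof. by case/andP: p12. Qed.

Lemma semigroup_le1 t f g : 0 <= t -> f \in Lfun mu 1%E -> g \in Lfun mu 1%E ->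
  {ae mu, forall x, f x <= g x} -> {ae mu, forall x, S t f x <= S t g x}.
Proof. by have [H _] := semigroupS; have [_] := H 1 (lexx _); apply. Qed.

Lemma semigroup_ge0_L1 t f : 0 < t -> f \in Lfun mu 1%E ->
  {ae mu, forall x, 0 <= f x} -> {ae mu, forall x, 0 <= S t f x}.
Proof.
move=> t0 lf f0; have [l1 l2] := Lfun1_truncation (lexx 0) lf.
set g := fun x => _ in l1 l2.
have g0 x : 0 <= g x by rewrite /g le_min lexx andbT le_max lexx orbT.
have gf : {ae mu, forall x, g x <= f x}.
  by apply: filterS f0 => x f0; rewrite ge_min max_l// lexx.
have H1 := semigroup_le1 (ltW t0) l1 lf gf.
have H2 := semigroup_ge0 p12 semigroupS t0 l2 (aeW _ g0).
by apply: filterS2 H1 H2 => x H1 H2; exact: le_trans H1.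
Qed.

Lemma shell_growth (x0 : E) r (gam : R) y : 0 < r -> 0 <= gam -> shell x0 r y ->
  r `^ gam <= enorm y `^ gam.
Proof.
move=> r0 g0 ys; have [_ ry] := shellP (Ordinal N_gt0) r0 ys.
have ry' := le_trans ry (enorm_ge y _).
by rewrite ge0_ler_powR ?nnegrE ?(ltW r0)// (le_trans (ltW r0)).
Qed.

(** Along any monotone approximation of [C |x|^gamma1] the hypothesis on the
    shells is eventually met, since it only involves measures. *)
Lemma eventually_large (C t1 t2 L M : R) (u0 : nat -> E -> R) (x0 : E) :
  0 < C -> 0 < t1 -> t1 <= t2 -> 0 < L ->
  (forall n, u0 n \in Lfun mu 1%E) ->
  monotone_approx u0 (fun x => C * enorm x `^ gamma1) ->
  \forall m \near \oo, forall t, t1 <= t -> t <= t2 ->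
    {ae mu, forall x, enorm (x - x0) < L -> M <= S t (u0 m) x}.
Proof.
move=> C0 t10 t12 L0 lu mono.
have C20 : 0 < C / 2 by rewrite divr_gt0.
have [n [rho [rho1 H]]] := @uniform_lower_bound R N s p N_gt0 s_gt0 p12 S semigroupS
  (C / 2) t1 t2 L M C20 t10 t12 L0.
pose kap j := C / 2 * rho j `^ gamma1.
have rho0 j : 0 < rho j by exact: lt_le_trans (rho1 j).
have kap0 j : 0 < kap j by rewrite mulr_gt0// powR_gt0.
pose K := \sum_(j < n) kap j.
have K0 : 0 <= K by apply: sumr_ge0 => j _; exact: ltW.
have kapK j : (j < n)%N -> kap j <= K.
  move=> jn; rewrite /K (bigD1 (Ordinal jn))//= lerDl.
  by apply: sumr_ge0 => i _; exact: ltW.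
pose f m x := Num.min (Num.max (u0 m x) 0) K.
have lf m : f m \in Lfun mu 1%E /\ f m \in L2 by exact: Lfun1_truncation.
have mf m : measurable_fun setT (f m) by exact: Lfun_measurable (lf m).1.
have f0 m x : 0 <= f m x by rewrite /f le_min K0 andbT le_max lexx orbT.
pose A j m := shell x0 (rho j) `&` [set x | f m x < kap j].
have small j : (j < n)%N -> \forall m \near \oo, (mu (A j m) <= (rho j ^+ N / 64)%:E)%E.
  move=> jn.
  have Soo : (mu (shell x0 (rho j)) < +oo)%E by rewrite lebesgue_shell// ltry.
  apply: (@measure_small_eventually _ _ _ mu (shell x0 (rho j)) (A j)).
  - exact: measurable_shell.
  - exact: Soo.
  - move=> m; apply: measurableI; first exact: measurable_shell.
    by rewrite -[X in measurable X]setTI; apply: measurable_fun_ltr.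
  - by move=> m; exact: subIsetl.
  - apply: filterS mono => x [_ _ ux].
    have [Sx|Sx] := pselect (shell x0 (rho j) x); last by apply: nearW => m -[].
    have kx : kap j < C * enorm x `^ gamma1.
      have := shell_growth (rho0 j) (ltW (gamma1_gt0 s_gt0 p12)) Sx.
      rewrite -(ler_pM2l C0); apply: lt_le_trans.
      by rewrite /kap ltr_pM2r ?powR_gt0//; lra.
    have Hgt := @cvgr_gt R _ \oo _ (fun m => u0 m x) _ ux _ kx.
    near=> m => -[_ /=]; have ukx : kap j < u0 m x by near: m; exact: Hgt.
    apply/negP.
    rewrite -leNgt /f le_min kapK// andbT le_max; apply/orP; left; exact: ltW.
  - by rewrite divr_gt0// exprn_gt0.
have small' : \forall m \near \oo, forall j, (j < n)%N ->
    (mu (A j m) <= (rho j ^+ N / 64)%:E)%E.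
  have := @near_forall_ltn (fun j m => (j < n)%N ->
    (mu (A j m) <= (rho j ^+ N / 64)%:E)%E) n.
  have H' j : \forall m \near \oo, (j < n)%N -> (mu (A j m) <= (rho j ^+ N / 64)%:E)%E.
    have [jn|jn] := boolP (j < n)%N; last by apply: nearW.
    by apply: filterS (small j jn).
  by move=> /(_ H'); apply: filterS => m Hm j jn; exact: Hm.
apply: filterS small' => m Hm t tt1 tt2.
have H1 := H x0 (f m) (lf m).2 (aeW _ (f0 m)) Hm t tt1 tt2.
have t0 : 0 <= t by rewrite (le_trans _ tt1)// ltW.
have fu : {ae mu, forall x, f m x <= u0 m x}.
  by apply: filterS mono => x [u00 _ _]; rewrite /f ge_min max_l ?lexx.
have H2 := semigroup_le1 t0 (lf m).1 (lu m) fu.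
by apply: filterS2 H1 H2 => x Hx1 Hx2 xL; exact: le_trans (Hx1 xL) Hx2.
Unshelve. all: by end_near. Qed.

End divergence.

(** * Divergence of the approximations *)

Section consequences.
Context {R : realType} {N : nat}.
Variables s p : R.
Hypothesis N_gt0 : (0 < N)%N.
Hypothesis s_gt0 : 0 < s.
Hypothesis p12 : 1 < p < 2.
Local Notation E := 'rV[R]_N.
Local Notation mu := (lebesgue_rV R N).
Local Notation L2 := (Lfun mu 2%:E).
Local Notation gamma1 := (s * p / (p - 1)).
Implicit Types (f g u v : E -> R) (x y : E) (r t : R).

Lemma measurable_eball x r : measurable (eball x r).
Proof.
rewrite -[X in measurable X]setTI; apply: measurable_fun_ltr => //.
apply: (measurableT_comp measurable_enorm).
have -> : (fun y : E => y - x) = affine_rV 1 (- x).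
  by apply/funext => y; rewrite /affine_rV scale1r.
exact: measurable_affine_rV.
Qed.

Lemma cubeP (c : E) r y : 0 < r ->
  cube c r y <-> forall i, 0 <= y ord0 i - c ord0 i <= r.
Proof.
move=> r0; have H i : (affine_rV r^-1 (- (r^-1 *: c)) y) ord0 i =
    (y ord0 i - c ord0 i) / r.
  by rewrite /affine_rV !mxE -mulrBr mulrC.
have r'0 : 0 < r^-1 by rewrite invr_gt0.
split=> Cy i; have := Cy i.
  by rewrite /= H in_itv/= (pmulr_lge0 _ r'0) ler_pdivrMr// mul1r.
by rewrite /= H in_itv/= (pmulr_lge0 _ r'0) ler_pdivrMr// mul1r.
Qed.

Lemma lebesgue_eball_lty x r : (mu (eball x r) < +oo)%E.
Proof.
have [r0|r0] := leP r 0.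
  have -> : eball x r = set0.
    apply/seteqP; split => // y; rewrite /eball/= ltNge => /negP; apply.
    by rewrite (le_trans r0)// sqrtr_ge0.
  by rewrite measure0.
have r20 : 0 < 2 * r by rewrite mulr_gt0.
apply: (@le_lt_trans _ _ (mu (cube (x - \row_i r) (2 * r)))).
  apply: le_measure; rewrite ?inE; [exact: measurable_eball|exact: measurable_cube|].
  move=> y /= yx; apply/cubeP => // i; rewrite !mxE.
  have := le_lt_trans (enorm_ge (y - x) i) yx; rewrite !mxE ltr_norml.
  by move=> /andP[h1 h2]; apply/andP; split; lra.
by rewrite lebesgue_cube// ltry.
Qed.

Lemma cube_sub_eball x r : 0 < r -> exists d, [/\ 0 < d, d < r &
  cube x d `<=` eball x r].
Proof.
move=> r0; have K0 : 0 <= Num.sqrt N%:R :> R by exact: sqrtr_ge0.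
have D0 : 0 < Num.sqrt N%:R + 2 :> R by lra.
exists (r / (Num.sqrt N%:R + 2)).
have d0 : 0 < r / (Num.sqrt N%:R + 2) by rewrite divr_gt0.
have dE : r / (Num.sqrt N%:R + 2) * (Num.sqrt N%:R + 2) = r by rewrite divfK// gt_eqF.
set d := r / _ in d0 dE *.
split => //; first by nra.
move=> y /(cubeP _ _ d0) Cy /=.
apply: (@le_lt_trans _ _ (Num.sqrt N%:R * d)); last by nra.
apply: enorm_le => [|i]; first exact: ltW.
by rewrite !mxE; have /andP[h1 h2] := Cy i; rewrite ger0_norm.
Qed.

Lemma lebesgue_eball_gt0 x r : 0 < r -> (0 < mu (eball x r))%E.
Proof.
move=> r0; have [d [d0 _ dsub]] := cube_sub_eball x r0.
apply: (@lt_le_trans _ _ (mu (cube x d))).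
  by rewrite lebesgue_cube// lte_fin exprn_gt0.
by apply: le_measure; rewrite ?inE//; [exact: measurable_cube|exact: measurable_eball].
Qed.

Lemma lebesgue_eballE x r : 0 < r -> exists2 m, 0 < m & mu (eball x r) = m%:E.
Proof.
move=> r0; have := lebesgue_eball_gt0 x r0; have := lebesgue_eball_lty x r.
by case: (mu (eball x r)) => [m| |]// _; rewrite lte_fin => m0; exists m.
Qed.

Lemma point_value_ge g x (r0 k : R) : 0 < r0 -> 0 <= k -> measurable_fun setT g ->
  {ae mu, forall y, enorm (y - x) < r0 -> k <= g y} -> (k%:E <= point_value g x)%E.
Proof.
move=> r00 k0 mg kg; rewrite /point_value limf_einfE.
set phi := fun r : R => _.
apply: (@le_trans _ _ (ereal_inf (phi @` [set r | 0 < r < r0]))); last first.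
  apply: ereal_sup_ubound; exists [set r | 0 < r < r0] => //=.
  near=> r; apply/andP; split; near: r; [exact: nbhs_right_gt|exact: nbhs_right_lt].
apply: le_ereal_inf_tmp => _ [r /andP[rr0 rr] <-]; rewrite /phi.
have [m m0 mE] := lebesgue_eballE x rr0.
have kr : {ae mu, forall y, eball x r y -> k <= g y}.
  by apply: filterS kg => y kg yr; apply: kg; exact: lt_trans rr.
have := ae_integral_ge_cst (measurable_eball x r) k0 (measurable_funTS mg) kr.
rewrite [X in (k%:E * X)%E]mE mE /= => H.
have m'0 : (0 <= (m^-1)%:E)%E by rewrite lee_fin invr_ge0 ltW.
apply: le_trans (lee_wpmul2l m'0 H).
by rewrite -!EFinM lee_fin mulrC mulfK// gt_eqF.
Unshelve. all: by end_near. Qed.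

Variable S : R -> (E -> R) -> E -> R.
Hypothesis semigroupS : fractional_p_semigroup s p S.

Section divergence_of_approximations.
Variables (C : R) (u0 : nat -> E -> R).
Hypothesis C0 : 0 < C.
Hypothesis lu : forall n, u0 n \in Lfun mu 1%E.
Hypothesis mono : monotone_approx u0 (fun x => C * enorm x `^ gamma1).

Let large t1 t2 L M x0 : 0 < t1 -> t1 <= t2 -> 0 < L ->
  \forall m \near \oo, forall t, t1 <= t -> t <= t2 ->
    {ae mu, forall x, enorm (x - x0) < L -> M <= S t (u0 m) x}.
Proof.
move=> t10 t12 L0.
exact: (eventually_large N_gt0 s_gt0 p12 semigroupS M x0 C0 t10 t12 L0 lu mono).
Qed.

Let mS t n : 0 <= t -> measurable_fun setT (S t (u0 n)).
Proof.
move=> t0; have [H _] := semigroupS; have [HS _] := H 1 (lexx _).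
exact: Lfun_measurable (semigroup_Lq HS t0 (lu n)).
Qed.

Lemma divergence_point_value t x : 0 < t ->
  point_value (S t (u0 n)) x @[n --> \oo] --> +oo%E.
Proof.
move=> t0; apply/cvgeyPge => A.
have := @large t t 1 (Num.max A 0) x t0 (lexx t) ltr01; apply: filterS => n H.
apply: (@le_trans _ _ (Num.max A 0)%:E); first by rewrite lee_fin le_max lexx.
apply: (@point_value_ge _ _ 1) => //.
- by rewrite le_max lexx orbT.
- by apply: mS; exact: ltW.
- exact: H.
Qed.

Lemma divergence_ae t : 0 < t -> {ae mu, forall x, S t (u0 n) x @[n --> \oo] --> +oo}.
Proof.
move=> t0.
have H k : {ae mu, forall x, \forall n \near \oo,
    enorm x < k.+1%:R -> k%:R <= S t (u0 n) x}.
  have [n0 _ Hn0] := @large t t k.+1%:R k%:R 0 t0 (lexx t) (ltr0Sn _ _).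
  have : {ae mu, forall x, forall n, (n0 <= n)%N -> enorm x < k.+1%:R -> k%:R <= S t (u0 n) x}.
    apply/ae_foralln => n; have [n0n|n0n] := leqP n0 n; last by apply: aeW => x.
    have := Hn0 n n0n t (lexx t) (lexx t).
    by apply: filterS => x Hx _; rewrite subr0 in Hx.
  by apply: filterS => x Hx; exists n0 => // n n0n; exact: Hx.
have {}H : {ae mu, forall x, forall k, \forall n \near \oo,
    enorm x < k.+1%:R -> k%:R <= S t (u0 n) x} by exact/ae_foralln.
apply: filterS H => x H; apply/cvgryPge => A.
pose k := (Num.truncn (`|A| + enorm x)).+1.
have kA : `|A| + enorm x < k%:R by exact: truncnS_gt.
have e0 : 0 <= enorm x by exact: sqrtr_ge0.
apply: filterS (H k) => n Hn; apply: le_trans (Hn _).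
  by have := ler_norm A; lra.
by rewrite -[k.+1%:R]natr1; have := normr_ge0 A; lra.
Qed.

Let large_integral t1 t2 x r A : 0 < t1 -> t1 <= t2 -> 0 < r ->
  \forall n \near \oo, forall t, t1 <= t -> t <= t2 ->
   (A%:E <= \int[mu]_(y in eball x r) (S t (u0 n) y)%:E)%E.
Proof.
move=> t10 t12 r0; have [m m0 mE] := lebesgue_eballE x r0.
have M0 : 0 <= Num.max A 0 / m by rewrite divr_ge0 ?(ltW m0)// le_max lexx orbT.
have := @large t1 t2 r (Num.max A 0 / m) x t10 t12 r0.
apply: filterS => n H t tt1 tt2.
have t0 : 0 <= t by rewrite (le_trans _ tt1)// ltW.
have := ae_integral_ge_cst (measurable_eball x r) M0 (measurable_funTS (mS n t0))
  (H t tt1 tt2).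
apply: le_trans; rewrite [X in (_ * X)%E]mE -EFinM lee_fin divfK ?gt_eqF//.
by rewrite le_max lexx.
Qed.

Lemma divergence_integral t x r : 0 < t -> 0 < r ->
  (\int[mu]_(y in eball x r) (S t (u0 n) y)%:E)%E @[n --> \oo] --> +oo%E.
Proof.
move=> t0 r0; apply/cvgeyPge => A.
have := @large_integral t t x r A t0 (lexx t) r0.
by apply: filterS => n; apply; exact: lexx.
Qed.

Lemma divergence_integral_time t1 t2 x r : 0 <= t1 -> t1 < t2 -> 0 < r ->
  (\int[lebesgue_measure]_(t in `]t1, t2[)
     \int[mu]_(y in eball x r) (S t (u0 n) y)%:E)%E @[n --> \oo] --> +oo%E.
Proof.
move=> t10 t12 r0; apply/cvgeyPge => A.
pose t3 := (t1 + t2) / 2.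
have [t31 t32] : t1 < t3 /\ t3 < t2 by rewrite /t3; split; lra.
have t30 : 0 < t3 by exact: le_lt_trans t31.
have d0 : 0 < t2 - t3 by rewrite subr_gt0.
have B0 : 0 <= Num.max A 0 / (t2 - t3).
  by rewrite divr_ge0 ?(ltW d0)// le_max lexx orbT.
have := @large_integral t3 t2 x r (Num.max A 0 / (t2 - t3)) t30 (ltW t32) r0.
apply: filterS => n H.
have := @ge0_integral_ge_cst R _ _ (@lebesgue_measure R) `]t1, t2[%classic
  `]t3, t2[%classic (fun t => \int[mu]_(y in eball x r) (S t (u0 n) y)%:E)%E
  (Num.max A 0 / (t2 - t3)) _ _ B0.
have leb : lebesgue_measure (`]t3, t2[%classic : set R) = (t2 - t3)%:E.
  by rewrite lebesgue_measure_itv/= lte_fin t32.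
rewrite [X in (_ * X)%E]leb -EFinM divfK ?gt_eqF// => K.
apply: le_trans (K _ _ _ _) => //.
- by rewrite lee_fin le_max lexx.
- by move=> t /=; rewrite !in_itv/= => /andP[h1 h2]; rewrite h2 (lt_trans t31).
- move=> t /=; rewrite in_itv/= => /andP[h1 h2].
  have t0 : 0 < t by exact: le_lt_trans h1.
  have := @ae_integral_ge_cst R _ _ mu (eball x r) (S t (u0 n)) 0
   (measurable_eball x r) (lexx 0) (measurable_funTS (mS n (ltW t0))).
  rewrite mul0e; apply.
  have u00 : {ae mu, forall x, 0 <= u0 n x} by apply: filterS mono => y [].
  have := semigroup_ge0_L1 p12 semigroupS t0 (lu n) u00.
  by apply: filterS => y.
- move=> t /=; rewrite in_itv/= => /andP[h1 h2].
  by apply: H; exact: ltW.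
Qed.

End divergence_of_approximations.

End consequences.

(** * Divergence of the profiles *)

Section profiles.
Context {R : realType} {N : nat}.
Variables s p C : R.
Hypothesis N_gt0 : (0 < N)%N.
Hypothesis s_gt0 : 0 < s.
Hypothesis p12 : 1 < p < 2.
Hypothesis C0 : 0 < C.
Local Notation E := 'rV[R]_N.
Local Notation mu := (lebesgue_rV R N).
Local Notation L2 := (Lfun mu 2%:E).
Local Notation gamma1 := (s * p / (p - 1)).
Implicit Types (f g u v : E -> R) (x y : E) (r t gam : R).
Variable S : R -> (E -> R) -> E -> R.
Hypothesis semigroupS : fractional_p_semigroup s p S.

(** The truncations of the datum at height and radius [k], one admissible
    approximating sequence for the minimal solution. *)
Definition truncated_power gam (k : nat) x : R :=
  if enorm x <= k%:R then Num.min (C * enorm x `^ gam) k%:R else 0.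

Lemma truncated_power_ge0 gam k x : 0 <= truncated_power gam k x.
Proof.
rewrite /truncated_power; case: ifP => // _.
by rewrite le_min ler0n andbT mulr_ge0 ?powR_ge0 ?(ltW C0).
Qed.

Lemma truncated_power_le gam k x :
  truncated_power gam k x <= k%:R * \1_(eball 0 k.+1%:R) x.
Proof.
rewrite /truncated_power; case: ifPn => [xk|_]; last by rewrite mulr_ge0// indicE.
rewrite indicE mem_set ?mulr1 ?ge_min ?lexx ?orbT//.
by rewrite /eball/= subr0 (le_lt_trans xk)// ltr_nat.
Qed.

Lemma measurable_truncated_power gam k : measurable_fun setT (truncated_power gam k).
Proof.
rewrite /truncated_power; apply: measurable_fun_ifT => //.
- by apply: measurable_fun_ler => //; exact: measurable_enorm.
- apply: measurable_minr => //; apply: measurable_funM => //.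
  by apply: (measurableT_comp (measurable_powR _)); exact: measurable_enorm.
Qed.

Lemma truncated_power_Lfun2 gam k : truncated_power gam k \in L2.
Proof.
have lB : (\1_(eball 0 k.+1%:R) : E -> R) \in L2.
  by apply: Lfun2_indic; [exact: measurable_eball|exact: lebesgue_eball_lty].
apply: (Lfun2_le _ _ (Lfun2Z k%:R lB)); first exact: measurable_truncated_power.
move=> x; rewrite !ger0_norm ?truncated_power_ge0 ?truncated_power_le//.
Qed.

Lemma truncated_power_Lfun1y gam k :
  truncated_power gam k \in Lfun mu 1%E /\ truncated_power gam k \in Lfun mu +oo%E.
Proof.
have mT := measurable_truncated_power gam k; split.
  apply/Lfun1_integrable; apply/integrableP; split; first exact/measurable_EFinP.
  have mB := @measurable_eball R N 0 k.+1%:R.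
  apply: (@le_lt_trans _ _ (\int[mu]_x (k%:R%:E * (\1_(eball 0 k.+1%:R) x)%:E))%E).
    apply: ge0_le_integral => //.
    - by apply/measurable_EFinP; apply: measurableT_comp.
    - by apply: measurable_funeM; apply/measurable_EFinP; exact: measurable_indic.
    move=> x _; rewrite /= -EFinM lee_fin ger0_norm ?truncated_power_ge0//.
    exact: truncated_power_le.
  have mI : measurable_fun setT (fun x : E => (\1_(eball 0 k.+1%:R) x)%:E : \bar R).
    by apply/measurable_EFinP; exact: measurable_indic.
  rewrite ge0_integralZl//.
  rewrite integral_indic// setIT.
  have [m _ mE] := @lebesgue_eballE R N 0 k.+1%:R (ltr0Sn R k).
  by rewrite [X in (_ * X)%E]mE -EFinM ltry.
rewrite inE; apply/andP; split; rewrite inE//= /finite_norm unlock /Lnorm.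
case: ifP => // _; apply: (@le_lt_trans _ _ k%:R%:E); last exact: ltry.
apply/ess_supP; apply: aeW => x /=.
rewrite lee_fin ger0_norm ?truncated_power_ge0//.
apply: (le_trans (truncated_power_le _ _ _)).
by rewrite indicE; case: (x \in _); rewrite ?mulr1 ?mulr0.
Qed.

Lemma truncated_power_approx gam :
  monotone_approx (truncated_power gam) (fun x => C * enorm x `^ gam).
Proof.
apply: aeW => x; split=> [k|k|]; first exact: truncated_power_ge0.
  rewrite {1}/truncated_power; case: ifP => xk; last exact: truncated_power_ge0.
  rewrite /truncated_power (le_trans xk) ?ler_nat//.
  rewrite le_min !ge_min lexx/=; apply/orP; right; rewrite ler_nat.
  exact: leqnSn.
apply: (cvg_trans _ (cvg_cst (C * enorm x `^ gam))).
  pose k0 := (Num.truncn (enorm x + C * enorm x `^ gam)).+1.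
  apply: near_eq_cvg; exists k0 => // k /= k0k.
  have kk : enorm x + C * enorm x `^ gam < k%:R.
    by apply: (lt_le_trans (truncnS_gt _)); rewrite ler_nat.
  have e0 : 0 <= enorm x by exact: sqrtr_ge0.
  have c0 : 0 <= C * enorm x `^ gam by rewrite mulr_ge0 ?powR_ge0 ?(ltW C0).
  rewrite /truncated_power ifT ?min_l//; lra.
exact: eventually_filter.
Qed.

Lemma continuous_ge (F : E -> R) x r (M : R) : continuous F -> 0 < r ->
  {ae mu, forall y, enorm (y - x) < r -> M <= F y} -> M <= F x.
Proof.
move=> cF r0 [A [mA A0 AF]]; rewrite leNgt; apply/negP => FM.
have : \forall y \near x, F y < M.
  exact: (@cvgr_lt R _ (nbhs x) _ F _ (cF x) _ FM).
move=> /nbhs_ballP[e /= e0 He].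
have re0 : 0 < Num.min r e by rewrite lt_min r0.
have [d [d0 de dsub]] := @cube_sub_eball R N x (Num.min r e) re0.
have : (mu (cube x d) <= mu A)%E.
  apply: le_measure; rewrite ?inE//; first exact: measurable_cube.
  move=> y Cy; apply: AF => /= H.
  have yr : enorm (y - x) < r.
    by apply: lt_le_trans (dsub y Cy) _; rewrite ge_min lexx.
  have := H yr; rewrite leNgt => /negP; apply; apply: He.
  split=> [|i j]; [exact: e0|rewrite (ord1 i) /ball/=].
  have /andP[h1 h2] := (cubeP x y d0).1 Cy j.
  rewrite distrC ger0_norm//; apply: (le_lt_trans h2).
  by apply: (lt_le_trans de); rewrite ge_min lexx orbT.
by rewrite A0 lebesgue_cube// leNgt lte_fin exprn_gt0.
Qed.

(** The finitely many shells of the uniform lower bound see no difference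
    between [C |x|^gamma] and [C |x|^gamma1] when [gamma] is close to
    [gamma1]; since they are the same for all centers, so is the bound. *)
Lemma profile_divergence (F : R -> E -> R) :
  (forall gam, 0 < gam < gamma1 -> selfsimilar_profile S s p C gam (F gam)) ->
  forall M, \forall gam \near gamma1^'-, forall x, M <= F gam x.
Proof.
move=> HF M.
have C20 : 0 < C / 2 by rewrite divr_gt0.
have g10 := gamma1_gt0 s_gt0 p12.
have [n [rho [rho1 H]]] := @uniform_lower_bound R N s p N_gt0 s_gt0 p12 S semigroupS
  (C / 2) 1 1 1 M C20 ltr01 (lexx 1) ltr01.
have rho0 j : 0 < rho j by exact: lt_le_trans (rho1 j).
pose r := 1 + \sum_(j < n) rho j.
have rhor j : (j < n)%N -> rho j <= r.
  move=> jn; rewrite /r (bigD1 (Ordinal jn))//=.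
  have : 0 <= \sum_(i < n | i != Ordinal jn) rho i by apply: sumr_ge0 => i _; exact: ltW.
  lra.
have r1 : 1 <= r by rewrite /r lerDl; apply: sumr_ge0 => i _; exact: ltW.
have r0 : 0 < r by exact: lt_le_trans r1.
have ln2 : 0 < ln 2 :> R by apply: ln_gt0; rewrite ltr1n.
have lnr : 0 <= ln r by exact: ln_ge0.
pose del := ln 2 / (ln r + 1).
have del0 : 0 < del by rewrite divr_gt0// ltr_wpDl.
near=> gam.
have gg1 : gam < gamma1 by near: gam; exact: nbhs_left_lt.
have g0 : 0 < gam by near: gam; exact: nbhs_left_gt.
have gdel : gamma1 - gam < del by near: gam; exact: nbhs_left_ltBl.
(* [del] is chosen for this: changing the exponent costs at most the factor 2
   that separates [C] from [C / 2] *)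
have gap : r `^ (gamma1 - gam) <= 2.
  rewrite -[leRHS]lnK ?posrE// /powR gt_eqF// ler_expR.
  apply: (@le_trans _ _ (del * ln r)); first by rewrite ler_wpM2r// ltW.
  rewrite /del mulrAC ler_pdivrMr ?ltr_wpDl// ler_pM2l//; lra.
have kap j y : (j < n)%N -> rho j <= enorm y ->
    C / 2 * rho j `^ gamma1 <= C * enorm y `^ gam.
  move=> jn yr.
  have -> : gamma1 = gam + (gamma1 - gam) by ring.
  rewrite powRD ?(gt_eqF (rho0 j)) ?implybT//.
  have H1 : rho j `^ (gamma1 - gam) <= 2.
    apply: le_trans gap; apply: ge0_ler_powR; rewrite ?nnegrE ?subr_ge0 ?(ltW gg1)//.
    - exact: ltW.
    - exact: ltW.
    - exact: rhor.
  have H2 : rho j `^ gam <= enorm y `^ gam.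
    apply: ge0_ler_powR; rewrite ?nnegrE ?(ltW g0) ?(ltW (rho0 j))//.
    exact: le_trans (ltW (rho0 j)) yr.
  apply: (@le_trans _ _ (C * rho j `^ gam)); last by rewrite ler_pM2l.
  have -> : C / 2 * (rho j `^ gam * rho j `^ (gamma1 - gam)) =
    C * rho j `^ gam * (rho j `^ (gamma1 - gam) / 2) by field.
  rewrite ler_piMr ?mulr_ge0 ?powR_ge0 ?(ltW C0)//; lra.
have [cF mF] := HF gam (introT andP (conj g0 gg1)).
move=> x0; apply: (continuous_ge (r := 1) cF ltr01).
have lim := mF (truncated_power gam) (truncated_power_Lfun1y gam)
  (truncated_power_approx gam) 1 ltr01.
pose k0 := (Num.truncn (Num.sqrt N%:R * (enorm x0 + 2 * r) + C * r `^ gamma1)).+1.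
have Hk k : (k0 <= k)%N -> {ae mu, forall x, enorm (x - x0) < 1 ->
    M <= S 1 (truncated_power gam k) x}.
  move=> k0k.
  have kk : Num.sqrt N%:R * (enorm x0 + 2 * r) + C * r `^ gamma1 < k%:R.
    by apply: (lt_le_trans (truncnS_gt _)); rewrite ler_nat.
  have e0 : 0 <= enorm x0 by exact: sqrtr_ge0.
  have k1 : 0 <= Num.sqrt N%:R * (enorm x0 + 2 * r).
    by rewrite mulr_ge0 ?sqrtr_ge0// addr_ge0// mulr_ge0// ltW.
  have k2 : 0 <= C * r `^ gamma1 by rewrite mulr_ge0 ?powR_ge0 ?(ltW C0).
  apply: (H x0 _ (truncated_power_Lfun2 gam k)) => //.
    by apply: aeW => x; exact: truncated_power_ge0.
  move=> j jn.
  have -> : shell x0 (rho j) `&` [set x | truncated_power gam k x <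
      C / 2 * rho j `^ gamma1] = set0.
    apply/seteqP; split => // y [ys /=]; rewrite ltNge => /negP; apply.
    have ry : rho j <= enorm y.
      have [_ ry] := shellP (Ordinal N_gt0) (rho0 j) ys.
      exact: le_trans ry (enorm_ge _ _).
    have yk : enorm y <= k%:R.
      apply: (@le_trans _ _ (Num.sqrt N%:R * (enorm x0 + 2 * r))); last lra.
      apply: enorm_le => [|i]; first by rewrite addr_ge0// mulr_ge0// ltW.
      have [/andP[_ h] _] := shellP i (rho0 j) ys.
      have -> : y ord0 i = x0 ord0 i + (y ord0 i - x0 ord0 i) by ring.
      apply: (le_trans (ler_normD _ _)); apply: lerD; first exact: enorm_ge.
      by apply: (le_trans h); rewrite ler_pM2l// rhor.
    rewrite /truncated_power yk le_min kap//=.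
    apply: (@le_trans _ _ (C * r `^ gamma1)); last lra.
    apply: ler_pM; rewrite ?powR_ge0 ?(ltW C20)//; first lra.
    by apply: ge0_ler_powR; rewrite ?nnegrE ?(ltW g10) ?(ltW (rho0 j)) ?(ltW r0) ?rhor.
  by rewrite measure0 lee_fin divr_ge0// exprn_ge0// ltW.
have Hall : {ae mu, forall x, forall k, (k0 <= k)%N -> enorm (x - x0) < 1 ->
    M <= S 1 (truncated_power gam k) x}.
  apply/ae_foralln => k; have [k0k|k0k] := leqP k0 k; last by apply: aeW.
  by apply: filterS (Hk k k0k) => x Hx _; exact: Hx.
apply: filterS2 lim Hall => x; rewrite !powR1 mul1r scale1r => lim Hx x1.
apply: (@cvgr_to_ge _ _ _ _ _ _ _ lim).
by exists k0 => // k /= k0k; exact: Hx.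
Unshelve. all: by end_near. Qed.

End profiles.

Theorem theorem6p3 (R : realType) (N : nat) (s p C : R)
    (S : R -> ('rV[R]_N -> R) -> 'rV[R]_N -> R)
    (N_ge1 : (1 <= N)%N) (s_bounds : 0 < s < 1) (p_bounds : 1 < p < 2)
    (C_gt0 : 0 < C) (semigroupS : fractional_p_semigroup s p S) :
  let mu := lebesgue_rV R N in
  let gamma1 := s * p / (p - 1) in
  (forall u0 : nat -> 'rV[R]_N -> R,
    (forall n, u0 n \in Lfun mu 1%E) ->
    monotone_approx u0 (fun x => C * enorm x `^ gamma1) ->
    let u n t := S t (u0 n) in
    [/\ forall t x, 0 < t ->
          point_value (u n t) x @[n --> \oo] --> +oo%E,
        forall t, 0 < t ->
          {ae mu, forall x, u n t x @[n --> \oo] --> +oo},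
        forall t x0 r, 0 < t -> 0 < r ->
          (\int[mu]_(x in eball x0 r) (u n t x)%:E)%E @[n --> \oo] --> +oo%E &
        forall T t1 t2 x0 r, 0 <= t1 -> t1 < t2 -> t2 <= T -> 0 < r ->
          (\int[lebesgue_measure]_(t in `]t1, t2[)
             \int[mu]_(x in eball x0 r) (u n t x)%:E)%E @[n --> \oo]
          --> +oo%E]) /\
  (forall F : R -> 'rV[R]_N -> R,
    (forall gamma, 0 < gamma < gamma1 ->
      selfsimilar_profile S s p C gamma (F gamma)) ->
    forall M, \forall gamma \near gamma1^'-, forall x, M <= F gamma x).
Proof.
have [s_gt0 _] := andP s_bounds.
move=> mu gamma1; split=> [u0 lu mono u|F HF M]; last first.
  exact: (profile_divergence N_ge1 s_gt0 p_bounds C_gt0 semigroupS HF M).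
split=> [t x t0|t t0|t x0 r t0 r0|T t1 t2 x0 r t10 t12 _ r0].
- exact: (divergence_point_value N_ge1 s_gt0 p_bounds semigroupS C_gt0 lu mono).
- exact: (divergence_ae N_ge1 s_gt0 p_bounds semigroupS C_gt0 lu mono).
- exact: (divergence_integral N_ge1 s_gt0 p_bounds semigroupS C_gt0 lu mono).
- exact: (divergence_integral_time N_ge1 s_gt0 p_bounds semigroupS C_gt0 lu mono).
Qed.
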